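(* Let $p\colon V\to M$ be a real vector bundle. If a diffeomorphism $\varphi\colon M\to M$ is homotopic to the identity map of $M$, then there exists $\Phi\in\mathrm{AUT}\,V$ such that $h_V(\Phi)=\varphi$.
   Context: All manifolds are connected, second countable, $C^\infty$, without boundary and finite-dimensional; all bundles are $C^\infty$. For a real vector bundle $p\colon V\to M$, $\mathrm{AUT}\,V$ is the group of diffeomorphisms $\Phi\colon V\to V$ mapping each fibre $V_x$ onto a fibre $V_{x'}$ by an $\mathbb{R}$-linear isomorphism, and $h_V\colon\mathrm{AUT}\,V\to\mathrm{Diff}\,M$ is the homomorphism sending $\Phi$ to the diffeomorphism $x\mapsto x'$ it induces on the base, so $p\circ\Phi=h_V(\Phi)\circ p$. Homotopic means $C^0$ homotopic, through continuous maps $M\to M$ (not necessarily diffeomorphisms). *)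

(* Defs.v *)
From HB Require Import structures.
From mathcomp Require Import all_boot all_order all_algebra.
From mathcomp Require Import all_classical all_reals all_analysis.

Set Implicit Arguments.
Unset Strict Implicit.
Unset Printing Implicit Defensive.

Import Order.TTheory GRing.Theory Num.Theory.
Import numFieldNormedType.Exports.

Local Open Scope classical_set_scope.
Local Open Scope ring_scope.

(* [W] is meant to be open: then the values of
   ['D_v f] on [W] only depend on the values of [f] on [W]. *)
Fixpoint Ck (R : realType) (m n : nat) (k : nat) (W : set 'rV[R]_m)
    (f : 'rV[R]_m -> 'rV[R]_n) : Prop :=
  if k is k'.+1 then
    (forall a, W a -> differentiable f a) /\ (forall v, Ck k' W ('D_v f))
  else forall a, W a -> {for a, continuous f}.

Definition Cinfty (R : realType) (m n : nat) (W : set 'rV[R]_m)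
    (f : 'rV[R]_m -> 'rV[R]_n) : Prop :=
  forall k, Ck k W f.

(* [chart_map] is only meaningful on [chart_dom], and [chart_inv] on the image
   of [chart_dom]. *)
Record chart (R : realType) (T : topologicalType) (n : nat) := Chart {
  chart_dom : set T;
  chart_map : T -> 'rV[R]_n;
  chart_inv : 'rV[R]_n -> T
}.

Record is_chart (R : realType) (T : topologicalType) (n : nat)
    (c : chart R T n) : Prop := IsChart {
  chart_dom_open : open (chart_dom c);
  chart_img_open : open (chart_map c @` chart_dom c);
  chart_mapK : forall x, chart_dom c x -> chart_inv c (chart_map c x) = x;
  chart_map_continuous : {within chart_dom c, continuous (chart_map c)};
  chart_inv_continuous :
    {within chart_map c @` chart_dom c, continuous (chart_inv c)}
}.

Record is_smooth_atlas (R : realType) (T : topologicalType) (n : nat)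
    (A : set (chart R T n)) : Prop := IsSmoothAtlas {
  atlas_chart : forall c, A c -> is_chart c;
  atlas_cover : forall x, exists2 c, A c & chart_dom c x;
  atlas_compatible : forall c d, A c -> A d ->
    Cinfty (chart_map c @` (chart_dom c `&` chart_dom d))
           (chart_map d \o chart_inv c)
}.

Record manifold (R : realType) := Manifold {
  manifold_space :> topologicalType;
  manifold_dim : nat;
  atlas : set (chart R manifold_space manifold_dim);
  manifold_smooth : is_smooth_atlas atlas;
  manifold_hausdorff : hausdorff_space manifold_space;
  manifold_second_countable : @second_countable manifold_space;
  manifold_connected : connected [set: manifold_space]
}.

(* Smoothness at the points of the open set [U], with respect to atlases [A]
   and [B] of the source and of the target. Continuity of [f] at [x] makes
   [chart_map d \o f \o chart_inv c] meaningful near [chart_map c x]. *)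
Definition smooth_on (R : realType) (S T : topologicalType) (m n : nat)
    (A : set (chart R S m)) (B : set (chart R T n)) (U : set S)
    (f : S -> T) : Prop :=
  forall x, U x -> {for x, continuous f} /\
    forall c d, A c -> B d -> chart_dom c x -> chart_dom d (f x) ->
      exists2 W, open_nbhs (chart_map c x) W
        & Cinfty W (chart_map d \o f \o chart_inv c).

Definition smooth (R : realType) (M N : manifold R) (f : M -> N) : Prop :=
  smooth_on (@atlas R M) (@atlas R N) setT f.

Definition Diff (R : realType) (M : manifold R) : set (M -> M) :=
  [set f | exists g : M -> M,
    [/\ cancel f g, cancel g f, smooth f & smooth g]].
Arguments Diff {R} M _.

Definition euclidean_atlas (R : realType) (n : nat) :
    set (chart R 'rV[R]_n n) :=
  [set Chart setT id id].

Definition prod_chart (R : realType) (S T : topologicalType) (m n : nat)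
    (c : chart R S m) (d : chart R T n) : chart R (S * T)%type (m + n) :=
  Chart (chart_dom c `*` chart_dom d)
    (fun z => row_mx (chart_map c z.1) (chart_map d z.2))
    (fun a => (chart_inv c (lsubmx a), chart_inv d (rsubmx a))).

Definition prod_atlas (R : realType) (S T : topologicalType) (m n : nat)
    (A : set (chart R S m)) (B : set (chart R T n)) :
    set (chart R (S * T)%type (m + n)) :=
  [set prod_chart c d | c in A & d in B].

(* The fibre of [p : V -> M] over [x] is presented as an abstract real vector
   space [E x] together with a bijection [i x] onto [p @^-1` [set x]].
   [v |-> (p v, h v)] is then a trivialization over [U]: a diffeomorphism of
   [p @^-1` U] onto [U `*` setT], with inverse [k], linear on each fibre. *)
Record is_trivialization (R : realType) (V M : manifold R) (p : V -> M)
    (E : M -> lmodType R) (i : forall x, E x -> V) (r : nat)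
    (U : set M) (h : V -> 'rV[R]_r) (k : M * 'rV[R]_r -> V) : Prop :=
  IsTrivialization {
    triv_open : open U;
    triv_linear : forall x, U x -> linear (h \o i x);
    triv_mapK : forall v, U (p v) -> k (p v, h v) = v;
    triv_invK : forall z, U z.1 -> (p (k z), h (k z)) = z;
    triv_smooth : smooth_on (@atlas R V)
      (prod_atlas (@atlas R M) (@euclidean_atlas R r))
      (p @^-1` U) (fun v => (p v, h v));
    triv_inv_smooth : smooth_on
      (prod_atlas (@atlas R M) (@euclidean_atlas R r)) (@atlas R V)
      (U `*` setT) k
  }.

Record vector_bundle (R : realType) (M : manifold R) := VectorBundle {
  total_space :> manifold R;
  bundle_rank : nat;
  proj : total_space -> M;
  fibre : M -> lmodType R;
  fibre_incl : forall x : M, fibre x -> total_space;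
  proj_smooth : smooth proj;
  fibre_incl_inj : forall x, injective (@fibre_incl x);
  fibre_incl_range : forall x, range (@fibre_incl x) = proj @^-1` [set x];
  locally_trivial : forall x : M, exists U h k,
    U x /\ @is_trivialization R total_space M proj fibre fibre_incl bundle_rank
             U h k
}.

Definition maps_fibre_iso (R : realType) (M : manifold R)
    (V : vector_bundle M) (Phi : V -> V) (x x' : M) : Prop :=
  exists2 L : {linear fibre V x -> fibre V x'}, bijective L
    & forall e, Phi (fibre_incl e) = fibre_incl (L e).

Definition AUT (R : realType) (M : manifold R) (V : vector_bundle M) :
    set (V -> V) :=
  [set Phi | Diff V Phi /\ forall x, exists x', maps_fibre_iso Phi x x'].
Arguments AUT {R M} V _.

(* For [Phi] in [AUT V] the point [x'] is unique, see [AUT_proj]; the value is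
   only meaningful in that case. *)
Definition hV (R : realType) (M : manifold R) (V : vector_bundle M)
    (Phi : V -> V) (x : M) : M :=
  xget x [set x' | maps_fibre_iso Phi x x'].

Lemma proj_incl (R : realType) (M : manifold R) (V : vector_bundle M)
    (x : M) (e : fibre V x) : proj (fibre_incl e) = x.
Proof.
have : range (@fibre_incl R M V x) (fibre_incl e) by exists e.
by rewrite fibre_incl_range.
Qed.

Lemma AUT_proj (R : realType) (M : manifold R) (V : vector_bundle M)
    (Phi : V -> V) : AUT V Phi -> @proj R M V \o Phi = hV Phi \o @proj R M V.
Proof.
move=> [_ Phi_fib]; apply/funext => v /=.
have : (@proj R M V @^-1` [set proj v]) v by [].
rewrite -fibre_incl_range => -[e _ <-]; rewrite proj_incl.
have /(xgetPex (proj v)) [L _ ->] := Phi_fib (proj v).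
by rewrite proj_incl.
Qed.

Definition homotopic (R : realType) (S T : topologicalType) (f g : S -> T) :
    Prop :=
  exists H : R * S -> T,
    [/\ {within `[0, 1]%classic `*` setT, continuous H},
        forall x, H (0, x) = f x & forall x, H (1, x) = g x].

(* Main.v *)
(* Over points that are close to each other the fibres of [V] are paired by
   [tau x y = sum_n rho_n(x) rho_n(y) <g_n -, g_n ->], where the [g_n] are local
   trivializations and the [rho_n] a locally finite family of bump functions;
   [tau x x] is an inner product on [V_x], so [tau x y] is nondegenerate for [y]
   near [x] and [tau x y (tau y y)^-1] transports [V_x] to [V_y]. Composing
   these transports along a subdivision of the homotopy into steps of length
   [eps x], with [eps] continuous, gives a continuous nondegenerate pairing [K]
   of [V_(phi x)] with [V_x]. The linear maps [B : V_x -> V_(phi x)] for which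
   [K (B v) v > 0] for all [v != 0] form a convex set of isomorphisms, so local
   smooth choices of [B] can be glued by a partition of unity. Such a smooth [B]
   is the required automorphism. *)

Require Import Defs.
From HB Require Import structures.
From mathcomp Require Import all_boot all_order all_algebra.
From mathcomp Require Import all_classical all_reals all_analysis.
From mathcomp Require Import lra.

Set Implicit Arguments.
Unset Strict Implicit.
Unset Printing Implicit Defensive.

Import Order.TTheory GRing.Theory Num.Theory.
Import numFieldNormedType.Exports.

Local Open Scope classical_set_scope.
Local Open Scope ring_scope.

(** * Calculus in coordinates *)

(** The homotopy is merely continuous and may pass through maps that are not injective, so there is
    no isotopy to lift and no vector field to integrate. What survives is a continuous transport,
    and smoothness is recovered only at the very end. Pairings suit this because nondegeneracy and
    positivity are open conditions: smoothing then never approximates [K], it only compares it with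
    matrices that are constant in local frames. As [M] may be noncompact, no single step length
    works, and with a length depending on [x] the number of steps jumps from point to point. The
    jumps are harmless because the homotopy is prolonged by the identity after time 1, where every
    further transport factor equals 1. Vectors are rows: linear maps act by right multiplication,
    and a change of frame enters the second argument of a pairing through its transpose. *)

Lemma continuous_row (T S : topologicalType) n (f : T -> 'rV[S]_n) (a : T) :
  (forall j, {for a, continuous (fun x => f x 0 j)}) -> {for a, continuous f}.
Proof.
move=> fc A [P fP PA]; apply: (filterS PA).
apply: filter_forall => i; apply: filter_forall => j.
by rewrite ord1 in fP *; apply: (fc j); apply: fP.
Qed.

(** Scalar counterpart of [Ck], for which products and reciprocals make sense; [CkP] returns to
    row-valued maps one coordinate at a time. *)
Fixpoint Sk (R : realType) (V : normedModType R) (k : nat) (W : set V)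
    (f : V -> R) : Prop :=
  if k is k'.+1 then
    (forall a, W a -> differentiable f a) /\ (forall v, Sk k' W ('D_v f))
  else forall a, W a -> {for a, continuous f}.

Lemma Sk_continuous (R : realType) (V : normedModType R) k (W : set V)
    (f : V -> R) : Sk k W f -> forall a, W a -> {for a, continuous f}.
Proof.
by case: k => [|k] //= [df _] a Wa; apply/differentiable_continuous/df.
Qed.

Lemma SkS (R : realType) (V : normedModType R) k (W : set V) (f : V -> R) :
  Sk k.+1 W f -> Sk k W f.
Proof.
elim: k f => [|k IH] f; first exact: Sk_continuous.
by move=> [df Df]; split=> // v; exact: IH.
Qed.

Lemma Sk_sub (R : realType) (V : normedModType R) k (W W' : set V)
    (f : V -> R) : W' `<=` W -> Sk k W f -> Sk k W' f.
Proof.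
move=> sub; elim: k f => [|k IH] f /=; first by move=> fc a /sub /fc.
by move=> [df Df]; split=> [a /sub /df//|v]; exact: IH.
Qed.

Lemma Ck_sub (R : realType) m n k (W W' : set 'rV[R]_m)
    (f : 'rV[R]_m -> 'rV[R]_n) : W' `<=` W -> Ck k W f -> Ck k W' f.
Proof.
move=> sub; elim: k f => [|k IH] f /=; first by move=> fc a /sub /fc.
by move=> [df Df]; split=> [a /sub /df//|v]; exact: IH.
Qed.

(** The first-order expansion of [f] at [a] is also one of [g], with the same differential. *)
Lemma near_eq_differentiable (R : realType) (V W : normedModType R)
    (f g : V -> W) a :
  {near a, f =1 g} -> differentiable f a -> differentiable g a.
Proof.
move=> fg df.
have fga : f a = g a by exact: nbhs_singleton fg.
have fg0 : \forall h \near (0 : V), f (h + a) = g (h + a).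
  by move: fg; rewrite (near_shift 0 a) subr0.
have E : g \o shift a = cst (g a) + 'd f a +o_ 0 id.
  apply/eqaddoP => _/posnumP[e]; have /eqaddoP := diff_locally df.
  move=> /(_ e%:num [gt0 of e%:num]); apply: filterS2 fg0 => h /= fgh.
  by rewrite !fctE /= fgh fga.
apply/diff_locallyP; rewrite (diff_unique (diff_continuous df) E).
by split; [exact: diff_continuous|].
Qed.

Lemma Sk_cst (R : realType) (V : normedModType R) k (W : set V) (c : R) :
  Sk k W (cst c).
Proof.
elim: k c => [|k IH] c /=; first by move=> a _; exact: cvg_cst.
split=> [a _|v]; first exact: differentiable_cst.
have -> : 'D_v (cst c : V -> R) = cst 0 by apply/funext => a; rewrite derive_cst.
exact: IH.
Qed.

Lemma Sk_ext (R : realType) (V : normedModType R) k (W : set V)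
    (f g : V -> R) : open W -> (forall a, W a -> f a = g a) ->
  Sk k W f -> Sk k W g.
Proof.
move=> oW; elim: k f g => [|k IH] f g fg /=.
  move=> fc a Wa; have fga : {near a, f =1 g}.
    by apply: filterS (open_nbhs_nbhs (conj oW Wa)) => b /fg.
  rewrite /prop_for /continuous_at -fg//.
  by apply: cvg_trans (fc a Wa); apply: near_eq_cvg.
move=> [df Df]; have fgn a : W a -> {near a, f =1 g}.
  by move=> Wa; apply: filterS (open_nbhs_nbhs (conj oW Wa)) => b /fg.
split=> [a Wa|v]; first exact: near_eq_differentiable (fgn a Wa) (df a Wa).
by apply: IH (Df v) => a Wa; exact: near_eq_derive (fgn a Wa).
Qed.

Lemma SkD (R : realType) (V : normedModType R) k (W : set V) (f g : V -> R) :
  open W -> Sk k W f -> Sk k W g -> Sk k W (f \+ g).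
Proof.
move=> oW; elim: k f g => [|k IH] f g /=.
  by move=> fc gc a Wa; apply: cvgD; [exact: fc|exact: gc].
move=> [df Df] [dg Dg]; split=> [a Wa|v].
  by apply: differentiableD; [exact: df|exact: dg].
apply: (@Sk_ext _ _ _ _ ('D_v f \+ 'D_v g)) => // [a Wa|]; last exact: IH.
rewrite deriveD; [by []|exact: diff_derivable (df _ Wa)|].
exact: diff_derivable (dg _ Wa).
Qed.

Lemma SkM (R : realType) (V : normedModType R) k (W : set V) (f g : V -> R) :
  open W -> Sk k W f -> Sk k W g -> Sk k W (f \* g).
Proof.
move=> oW; elim: k f g => [|k IH] f g.
  by move=> fc gc a Wa; apply: cvgM; [exact: fc|exact: gc].
move=> Sf Sg; have [[df Df] [dg Dg]] := (Sf, Sg); split=> [a Wa|v].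
  by apply: differentiableM; [exact: df|exact: dg].
apply: (@Sk_ext _ _ _ _ ((f \* 'D_v g) \+ (g \* 'D_v f))) => // [a Wa|].
  rewrite deriveM; [by []|exact: diff_derivable (df _ Wa)|].
  exact: diff_derivable (dg _ Wa).
apply: SkD => //; apply: IH.
- exact: SkS Sf.
- exact: Dg.
- exact: SkS Sg.
- exact: Df.
Qed.

Lemma SkV (R : realType) (V : normedModType R) k (W : set V) (f : V -> R) :
  open W -> (forall a, W a -> f a != 0) -> Sk k W f ->
  Sk k W (fun a => (f a)^-1).
Proof.
move=> oW f0; elim: k f f0 => [|k IH] f f0.
  by move=> fc a Wa; apply: cvgV; [exact: f0|exact: fc].
move=> Sf; have [df Df] := Sf; split=> [a Wa|v].
  by apply: differentiableV; [exact: df|exact: f0].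
pose g a := (f a)^-1.
apply: (@Sk_ext _ _ _ _ (cst (-1) \* ((g \* g) \* 'D_v f))) => // [a Wa|].
  rewrite /= deriveV//; [|exact: f0|exact/diff_derivable/df].
  by rewrite mulN1r /g -invfM scaleNr.
have Sg : Sk k W g by apply: IH => //; exact: SkS.
apply: SkM => //; first exact: Sk_cst.
by apply: SkM; [| exact: SkM|exact: Df].
Qed.

Lemma Sk_coord (R : realType) n k (W : set 'rV[R]_n) j :
  Sk k W (fun a => a 0 j).
Proof.
case: k => [|k] /=; first by move=> a _; exact: coord_continuous.
split=> [a _|v]; first exact: differentiable_coord.
suff -> : 'D_v (fun a : 'rV[R]_n => a 0 j) = cst (v 0 j) by exact: Sk_cst.
apply/funext => a /=.
have H := @derive_mx R 'rV[R]_n 1 n id a v (@derivable_id _ _ a v).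
by move: H; rewrite derive_id => /matrixP /(_ 0 j); rewrite mxE.
Qed.

Lemma Sk_sum (R : realType) (V : normedModType R) k (W : set V) (I : Type)
    (s : seq I) (P : pred I) (f : I -> V -> R) :
  open W -> (forall i, P i -> Sk k W (f i)) ->
  Sk k W (fun a => \sum_(i <- s | P i) f i a).
Proof.
move=> oW Sf; elim: s => [|i s IH].
  by under eq_fun do rewrite big_nil; exact: Sk_cst.
under eq_fun do rewrite big_cons.
case: (boolP (P i)) => [Pi|//].
by apply: SkD => //; exact: Sf.
Qed.

Lemma derive_comp (R : realType) (V : normedModType R) n (f : V -> 'rV[R]_n)
    (g : 'rV[R]_n -> R) a v :
  differentiable f a -> differentiable g (f a) ->
  'D_v (g \o f) a = \sum_j 'D_v (fun x => f x 0 j) a * 'D_('e_j) g (f a).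
Proof.
move=> df dg; rewrite (deriveE v (differentiable_comp df dg)).
rewrite diff_comp//= -(deriveE v df) (@derive_mx _ _ 1 n f a v (diff_derivable df)).
rewrite [X in 'd _ _ X]row_sum_delta linear_sum; apply: eq_bigr => j _.
by rewrite linearZ /= mxE -(deriveE _ dg).
Qed.

Lemma differentiable_row (R : realType) (V : normedModType R) n
    (f : V -> 'rV[R]_n) a :
  (forall j, differentiable (fun x => f x 0 j) a) -> differentiable f a.
Proof.
move=> df; have -> : f = \sum_(j < n) (fun x => f x 0 j *: 'e_j).
  apply/funext => x; rewrite [LHS]row_sum_delta fct_sumE.
  by apply: eq_bigr.
by apply: differentiable_sum => j; apply: differentiableZl.
Qed.

(** The chain rule gives a sum of products of derivatives of the coordinates of [f] with partial
    derivatives of [g] composed with [f]. The latter are again compositions with [f], so the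
    induction fixes [f] and generalizes [g]. *)
Lemma Sk_comp (R : realType) (V : normedModType R) n k (W : set V)
    (W' : set 'rV[R]_n) (f : V -> 'rV[R]_n) (g : 'rV[R]_n -> R) :
  open W -> open W' -> (forall a, W a -> W' (f a)) ->
  (forall j, Sk k W (fun x => f x 0 j)) -> Sk k W' g -> Sk k W (g \o f).
Proof.
move=> oW oW' WW'; elim: k g => [|k IH] g Sf.
  move=> gc a Wa; apply: continuous_comp; last exact/gc/WW'.
  by apply: continuous_row => j; exact: Sf.
move=> [dg Dg]; have df a : W a -> differentiable f a.
  by move=> Wa; apply: differentiable_row => j; apply: (Sf j).1.
split=> [a Wa|v].
  by apply: differentiable_comp; [exact: df|exact/dg/WW'].
apply: (@Sk_ext _ _ _ _ (fun a => \sum_j ('D_v (fun x => f x 0 j) \*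
    ('D_('e_j) g \o f)) a)) => // [a Wa|].
  by rewrite derive_comp//; [exact: df|exact/dg/WW'].
apply: Sk_sum => // j _; apply: SkM => //; first exact: (Sf j).2.
by apply: IH => [i|]; [exact: SkS|exact: Dg].
Qed.

Lemma differentiable_coord_of (R : realType) (V : normedModType R) n
    (f : V -> 'rV[R]_n) a j :
  differentiable f a -> differentiable (fun x => f x 0 j) a.
Proof.
move=> df; apply: (@differentiable_comp _ _ _ _ f (fun u => u 0 j)) => //.
exact: differentiable_coord.
Qed.

Lemma CkP (R : realType) m n k (W : set 'rV[R]_m) (f : 'rV[R]_m -> 'rV[R]_n) :
  open W -> Ck k W f <-> forall j, Sk k W (fun x => f x 0 j).
Proof.
move=> oW; elim: k f => [|k IH] f /=.
  split=> [fc j a Wa|fc a Wa]; last by apply: continuous_row => j; exact: fc.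
  apply: (@continuous_comp _ _ _ f (fun u => u 0 j)); first exact: fc.
  exact: coord_continuous.
split=> [[df Df] j|Sf].
  split=> [a Wa|v]; first exact/differentiable_coord_of/df.
  apply: (@Sk_ext _ _ _ _ (fun a => 'D_v f a 0 j)) => // [a Wa|].
    by rewrite (derive_mx (diff_derivable (df a Wa))) mxE.
  exact: (IH _).1 (Df v) j.
have df a : W a -> differentiable f a.
  by move=> Wa; apply: differentiable_row => j; apply: (Sf j).1.
split=> // v; apply/IH => j.
apply: (@Sk_ext _ _ _ _ ('D_v (fun x => f x 0 j))) => // [a Wa|].
  by rewrite (derive_mx (diff_derivable (df a Wa))) mxE.
exact: (Sf j).2.
Qed.

(* Indexing by [p] makes the family closed under differentiation. *)
Definition flat (R : realType) (p : nat) (t : R) : R :=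
  if 0 < t then t^-1 ^+ p * expR (- t^-1) else 0.

Lemma flat_gt0 (R : realType) p (t : R) : 0 < t -> 0 < flat p t.
Proof. by move=> t0; rewrite /flat t0 mulr_gt0 ?expR_gt0 ?exprn_gt0 ?invr_gt0. Qed.

Lemma flat_le0 (R : realType) p (t : R) : t <= 0 -> flat p t = 0.
Proof. by rewrite /flat ltNge => ->. Qed.

Lemma flat_ge0 (R : realType) p (t : R) : 0 <= flat p t.
Proof. by have [/(flat_le0 p) ->|/(flat_gt0 p)/ltW] := leP t 0. Qed.

(** With [m = p + 2] and [u = 1 / t], the inequality [expR (u / m) >= u / m] raised to the power [m]
    bounds [expR u] below by [(u / m) ^ m]. The two exponents beyond [p] leave the factor [t ^+ 2],
    which makes the derivative at 0 vanish. *)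
Lemma flat_le (R : realType) p (t : R) :
  flat p t <= (p.+2)%:R ^+ p.+2 * t ^+ 2.
Proof.
have [t0|t0] := leP t 0; first by rewrite flat_le0// mulr_ge0 ?sqr_ge0 ?exprn_ge0.
rewrite /flat t0 expRN.
set m := p.+2; have m0 : 0 < m%:R :> R by rewrite ltr0n.
have : (t^-1 / m%:R) ^+ m <= expR t^-1.
  rewrite -[in leRHS](divfK (lt0r_neq0 m0) t^-1) expRM_natr.
  apply: lerXn2r; rewrite ?nnegrE ?expR_ge0//.
    by rewrite divr_ge0 ?invr_ge0 ?ltW.
  by apply: le_trans (expR_ge1Dx _); rewrite lerDr.
rewrite exprMn => le; rewrite ler_pdivrMr ?expR_gt0//.
have -> : t^-1 ^+ p = m%:R ^+ m * t ^+ 2 * (t^-1 ^+ m * m%:R^-1 ^+ m).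
  rewrite [t^-1 ^+ m * _]mulrC mulrACA -exprMn mulfV ?lt0r_neq0// expr1n mul1r.
  by rewrite /m -[p.+2]addn2 exprD mulrCA -exprMn mulfV ?lt0r_neq0// expr1n mulr1.
by rewrite ler_pM2l// mulr_gt0 ?exprn_gt0.
Qed.

Lemma is_derive_flat (R : realType) p (t : R) :
  is_derive t 1 (@flat R p) (flat p.+2 t - p%:R * flat p.+1 t).
Proof.
have [t0|t0|->] := ltgtP t 0.
- rewrite !flat_le0 ?ltW// mulr0 subr0.
  apply: (@near_eq_is_derive _ _ _ (cst 0)).
  near=> s; rewrite flat_le0// ltW//; near: s; exact: lt_nbhsl.
- apply: (@near_eq_is_derive _ _ _ (fun s : R => s^-1 ^+ p * expR (- s^-1))).
    by near=> s; rewrite /flat ifT//; near: s; exact: lt_nbhsr.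
  have tn0 := lt0r_neq0 t0.
  have dV : is_derive t 1 (fun s : R => s^-1) (- t ^- 2).
    by apply: is_derive_eq (is_deriveV tn0 (is_derive_id t 1)) _; rewrite scaler1.
  have dN : is_derive t 1 (fun s : R => - s^-1) (t ^- 2).
    by apply: is_derive_eq (is_deriveN dV) _; rewrite opprK.
  have dE := @is_derive1_comp R expR (fun s : R => - s^-1) t _ _
    (is_derive_expR (- t^-1)) dN.
  have dX := is_deriveX p dV.
  have dM := is_deriveM dX dE.
  have -> : (fun s : R => s^-1 ^+ p * expR (- s^-1)) =
      (fun s => s^-1) ^+ p * (expR \o (fun s => - s^-1)).
    by apply/funext => s; rewrite !fctE.
  apply: (is_derive_eq dM).
  rewrite /flat t0 !exprfctE -!exprVn /GRing.scale /=.
  case: p {dX dM} => [|p] /=; last by rewrite !exprS; lra.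
  by rewrite !expr0 !mul0r mulr0 addr0 subr0 mul1r mulrC.
- rewrite !flat_le0// mulr0 subr0.
  (* By [flat_le] the difference quotient at 0 is bounded by [C] times the absolute value of the
     increment. *)
  pose C : R := p.+2%:R ^+ p.+2.
  have C0 : 0 < C by rewrite exprn_gt0// ltr0n.
  suff H : h^-1 *: (flat p (h *: 1 + 0) - flat p 0) @[h --> (0 : R)^'] --> (0 : R).
    by apply: DeriveDef; [apply/cvg_ex; exists 0|apply/cvg_lim].
  apply/cvgr0Pnorm_le => e e0.
  near=> h.
  have hn0 : h != 0 by near: h; exact: nbhs_dnbhs_neq.
  rewrite (flat_le0 _ (lexx 0)) subr0 addr0 /GRing.scale /= mulr1 normrM normfV.
  rewrite ler_pdivrMl ?normr_gt0// (ger0_norm (flat_ge0 _ _)).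
  apply: le_trans (flat_le _ _) _; rewrite -/C -real_normK ?num_real// expr2 mulrA.
  rewrite [leRHS]mulrC ler_wpM2r// -ler_pdivlMl// mulrC.
  near: h; apply: dnbhs0_le; exact: divr_gt0.
Unshelve. all: by end_near. Qed.

Lemma Sk_flat (R : realType) (V : normedModType R) k (W : set V) p (f : V -> R) :
  open W -> Sk k W f -> Sk k W (fun a => flat p (f a)).
Proof.
move=> oW; have dflat q t : differentiable (@flat R q) t.
  by apply/derivable1_diffP; have [] := is_derive_flat q t.
elim: k p f => [|k IH] p f.
  move=> fc a Wa; apply: (@continuous_comp _ _ _ f (@flat R p)); first exact: fc.
  exact/differentiable_continuous/dflat.
move=> Sf; have [df Df] := Sf; split=> [a Wa|v].
  by apply: (@differentiable_comp _ _ _ _ f (@flat R p)); [exact: df|].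
apply: (@Sk_ext _ _ _ _ (((fun a => flat p.+2 (f a)) \+
    (cst (- p%:R) \* (fun a => flat p.+1 (f a)))) \* 'D_v f)) => // [a Wa|].
  have dfa := df a Wa.
  rewrite [RHS](deriveE v (differentiable_comp dfa (dflat p (f a)))).
  rewrite (diff_comp dfa)//= -(deriveE v dfa) diff1E// derive1E.
  have [_ ->] := is_derive_flat p (f a).
  by rewrite mulNr mulrC.
apply: SkM => //; last exact: Df.
apply: SkD => //; first by apply: IH; exact: SkS.
by apply: SkM => //; [exact: Sk_cst|apply: IH; exact: SkS].
Qed.

(** * Smooth maps at a point *)

Lemma nbhs_open_nbhs (T : topologicalType) (x : T) (P : set T) :
  nbhs x P -> exists2 W, open_nbhs x W & W `<=` P.
Proof. by rewrite nbhsE. Qed.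

Lemma within_open_continuous (S T : topologicalType) (A : set S) (f : S -> T) x :
  open A -> {within A, continuous f} -> A x -> {for x, continuous f}.
Proof.
move=> oA; rewrite continuous_open_subspace// => fc Ax.
by apply: fc; rewrite inE.
Qed.

Section Charts.
Variables (R : realType) (T : topologicalType) (n : nat).
Implicit Types (c : chart R T n) (x : T).

Lemma chart_dom_nbhs c x : is_chart c -> chart_dom c x -> nbhs x (chart_dom c).
Proof. by move=> [oD _ _ _ _] Dx; exact: open_nbhs_nbhs. Qed.

Lemma chart_map_cts c x :
  is_chart c -> chart_dom c x -> {for x, continuous (chart_map c)}.
Proof. by move=> cc; apply: within_open_continuous; case: cc. Qed.

Lemma chart_inv_cts c x : is_chart c -> chart_dom c x ->
  {for chart_map c x, continuous (chart_inv c)}.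
Proof.
move=> cc Dx; apply: within_open_continuous (chart_inv_continuous cc) _.
  exact: chart_img_open.
by exists x.
Qed.

Lemma chart_inv_near c x (P : set T) : is_chart c -> chart_dom c x ->
  nbhs x P -> \forall z \near chart_map c x, P (chart_inv c z).
Proof.
move=> cc Dx Px; apply: (chart_inv_cts cc Dx).
by rewrite chart_mapK.
Qed.

End Charts.

(** Convertible to what [smooth_on] demands at each single point, so that smoothness can be argued
    on germs. *)
Definition smooth_pt (R : realType) (S T : topologicalType) (m n : nat)
    (A : set (chart R S m)) (B : set (chart R T n)) (x : S) (f : S -> T) :
    Prop :=
  {for x, continuous f} /\
    forall c d, A c -> B d -> chart_dom c x -> chart_dom d (f x) ->
      exists2 W, open_nbhs (chart_map c x) W
        & Cinfty W (chart_map d \o f \o chart_inv c).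

Lemma CinftyP (R : realType) m n (W : set 'rV[R]_m) (f : 'rV[R]_m -> 'rV[R]_n) :
  open W -> Cinfty W f <-> forall j k, Sk k W (fun x => f x 0 j).
Proof.
move=> oW; split=> [Cf j k|Sf k]; first by have /(CkP _ _ oW) := Cf k.
by apply/(CkP _ _ oW) => j.
Qed.

Lemma Cinfty_continuous (R : realType) m n (W : set 'rV[R]_m)
  (f : 'rV[R]_m -> 'rV[R]_n) : Cinfty W f -> forall a, W a -> {for a, continuous f}.
Proof. by move=> /(_ 0%N). Qed.

Section SmoothPt.
Variables (R : realType) (S T X : topologicalType) (m n p : nat).
Variables (A : set (chart R S m)) (B : set (chart R T n)) (C : set (chart R X p)).
Hypothesis chA : forall c, A c -> is_chart c.

Lemma smooth_pt_near (x : S) (f g : S -> T) :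
  {near x, f =1 g} -> smooth_pt A B x f -> smooth_pt A B x g.
Proof.
move=> fg [fc fs]; have fgx : f x = g x by exact: nbhs_singleton fg.
split.
  rewrite /prop_for /continuous_at -fgx.
  by apply: cvg_trans fc; apply: near_eq_cvg.
move=> c d Ac Bd cx; rewrite -fgx => dfx.
have [W [oW Wx] CW] := fs c d Ac Bd cx dfx.
have [W' [oW' W'x] eqW'] := nbhs_open_nbhs (chart_inv_near (chA Ac) cx fg).
exists (W `&` W'); first by split; [exact: openI|].
apply/(CinftyP _ (openI oW oW')) => j k.
apply: (@Sk_ext _ _ _ _ (fun z => (chart_map d \o f \o chart_inv c) z 0 j)).
- exact: openI.
- by move=> z [_ /eqW' /= ->].
- apply: (Sk_sub (@subIsetl _ W W')).
  by have /(CinftyP _ oW) := CW; apply.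
Qed.

Hypothesis chB : forall c, B c -> is_chart c.
Hypothesis covB : forall x, exists2 c, B c & chart_dom c x.

(** A chart [e] around [f x] splits the local expression of the composite into those of [f] and [g].
    The splitting is valid where [f] stays in the domain of [e], a neighbourhood of [x] by
    continuity. *)
Lemma smooth_pt_comp (x : S) (f : S -> T) (g : T -> X) :
  smooth_pt A B x f -> smooth_pt B C (f x) g -> smooth_pt A C x (g \o f).
Proof.
move=> [fc fs] [gc gs]; split; first exact: continuous_comp.
move=> c d Ac Cd cx dx; have [e Be ex] := covB (f x).
have [W [oW Wx] CW] := fs c e Ac Be cx ex.
have [W' [oW' W'x] CW'] := gs e d Be Cd ex dx.
have fe : nbhs x (fun y => chart_dom e (f y)).
  by apply: fc; exact: chart_dom_nbhs (chB Be) ex.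
have N1 := chart_inv_near (chA Ac) cx fe.
have N2 : nbhs (chart_map c x)
    ((chart_map e \o f \o chart_inv c) @^-1` W').
  apply: (Cinfty_continuous CW Wx).
  by rewrite /= (chart_mapK (chA Ac))//; exact: open_nbhs_nbhs.
have [W1 [oW1 W1x] sW1] := nbhs_open_nbhs (filterI (open_nbhs_nbhs (conj oW Wx))
  (filterI N1 N2)).
exists W1 => //; apply/(CinftyP _ oW1) => j k.
apply: (@Sk_ext _ _ _ _ ((fun u => (chart_map d \o g \o chart_inv e) u 0 j) \o
    (chart_map e \o f \o chart_inv c))) => //.
  by move=> z /sW1 [_ [/= ez _]]; rewrite (chart_mapK (chB Be)).
apply: (@Sk_comp _ _ _ _ _ W') => //.
- by move=> a /sW1 [_ []].
- move=> i; apply: (@Sk_sub _ _ _ W) => [z /sW1 []//|].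
  by have /(CinftyP _ oW) := CW; apply.
- by have /(CinftyP _ oW') := CW'; apply.
Qed.

End SmoothPt.

Lemma row_continuous_coord (T S : topologicalType) n (f : T -> 'rV[S]_n) a j :
  {for a, continuous f} -> {for a, continuous (fun x => f x 0 j)}.
Proof.
move=> fc A fA; apply: (fc [set u : 'rV[S]_n | A (u 0 j)]).
exists (fun i k => if k == j then A else setT) => [i k|u /= /(_ 0 j)].
  by rewrite ord1; case: eqP => [->//|_]; exact: filterT.
by rewrite eqxx.
Qed.

Lemma continuous_row_mx (T S : topologicalType) m n (f : T -> 'rV[S]_m)
    (g : T -> 'rV[S]_n) a :
  {for a, continuous f} -> {for a, continuous g} ->
  {for a, continuous (fun x => row_mx (f x) (g x))}.
Proof.
move=> fc gc; apply: continuous_row => j.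
rewrite (_ : (fun x : T => _) = (fun x : T => match fintype.split j with
  inl i => f x 0 i | inr i => g x 0 i end)); last first.
  by apply/funext => x; rewrite mxE.
by case: fintype.split => i; exact: row_continuous_coord.
Qed.

Lemma open_continuous_continuous (S T : topologicalType) (A : set S) (f : S -> T) :
  open A -> (forall x, A x -> {for x, continuous f}) -> {within A, continuous f}.
Proof.
by move=> oA fc; rewrite continuous_open_subspace// => x /[!inE]; exact: fc.
Qed.

Lemma prod_chart_img (R : realType) (S T : topologicalType) m n
    (c : chart R S m) (d : chart R T n) :
  chart_map (prod_chart c d) @` chart_dom (prod_chart c d) =
  [set z | (chart_map c @` chart_dom c) (lsubmx z) /\
           (chart_map d @` chart_dom d) (rsubmx z)].
Proof.
apply/seteqP; split=> z /=.
  move=> [[x y] [/= cx dy] <-]; rewrite row_mxKl row_mxKr.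
  by split; [exists x|exists y].
move=> [[x cx xz] [y dy yz]]; exists (x, y) => //=.
by rewrite xz yz hsubmxK.
Qed.

Lemma prod_chart_is_chart (R : realType) (S T : topologicalType) m n
    (c : chart R S m) (d : chart R T n) :
  is_chart c -> is_chart d -> is_chart (prod_chart c d).
Proof.
move=> cc cd.
have oI : open (chart_map (prod_chart c d) @` chart_dom (prod_chart c d)).
  rewrite prod_chart_img; apply: openI.
    apply: (@open_comp _ _ lsubmx) => [z _|]; first exact: continuous_lsubmx.
    exact: chart_img_open.
  apply: (@open_comp _ _ rsubmx) => [z _|]; first exact: continuous_rsubmx.
  exact: chart_img_open.
have oD : open (chart_dom (prod_chart c d)).
  rewrite (_ : chart_dom _ = (fst @^-1` chart_dom c) `&` (snd @^-1` chart_dom d))//.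
  apply: openI; apply: open_comp => [z _|]; try exact: chart_dom_open.
    exact: cvg_fst.
  exact: cvg_snd.
split=> //.
- by move=> [x y] [/= cx dy]; rewrite row_mxKl row_mxKr !chart_mapK.
- apply: open_continuous_continuous => // -[x y] [/= cx dy].
  apply: continuous_row_mx.
    apply: (@continuous_comp _ _ _ fst (chart_map c)); first exact: cvg_fst.
    exact: chart_map_cts.
  apply: (@continuous_comp _ _ _ snd (chart_map d)); first exact: cvg_snd.
  exact: chart_map_cts.
- apply: open_continuous_continuous => // z.
  rewrite prod_chart_img => -[[x cx xz] [y dy yz]].
  have h1 : {for z, continuous (chart_inv c \o lsubmx)}.
    apply: continuous_comp; first exact: continuous_lsubmx.
    by rewrite -xz; exact: chart_inv_cts.
  have h2 : {for z, continuous (chart_inv d \o rsubmx)}.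
    apply: continuous_comp; first exact: continuous_rsubmx.
    by rewrite -yz; exact: chart_inv_cts.
  exact: cvg_pair h1 h2.
Qed.

Lemma euclidean_is_chart (R : realType) n (c : chart R 'rV[R]_n n) :
  @euclidean_atlas R n c -> is_chart c.
Proof.
have cts : {within [set: 'rV[R]_n], continuous id}.
  by apply: open_continuous_continuous => [|x _ P //]; exact: openT.
by move=> ->; split; rewrite /= ?image_id //; exact: openT.
Qed.

Section ProdAtlas.
Variables (R : realType) (M : manifold R) (r : nat).

Definition triv_atlas : set (chart R (M * 'rV[R]_r)%type _) :=
  prod_atlas (@atlas R M) (@euclidean_atlas R r).

Lemma atlas_is_chart c : @atlas R M c -> is_chart c.
Proof. exact: (atlas_chart (manifold_smooth M)). Qed.

Lemma atlas_covers (x : M) : exists2 c, @atlas R M c & chart_dom c x.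
Proof. exact: (atlas_cover (manifold_smooth M)). Qed.

Lemma triv_atlas_is_chart c : triv_atlas c -> is_chart c.
Proof.
move=> [c1 Ac1 [d Ad <-]]; apply: prod_chart_is_chart.
  exact: atlas_is_chart.
exact: euclidean_is_chart.
Qed.

Lemma triv_atlas_covers z : exists2 c, triv_atlas c & chart_dom c z.
Proof.
have [c Ac cz] := atlas_covers z.1.
exists (prod_chart c (Chart setT id id)) => //.
by exists c => //; exists (Chart setT id id).
Qed.

End ProdAtlas.

(** * Rings of germs and matrices over them *)

(** Collects what continuity at a point and smoothness at a point have in common, so that matrix
    products, determinants and inverses are treated once for both. *)
Record germ_ring (R : realType) (X : topologicalType) (x : X)
    (P : (X -> R) -> Prop) : Prop := GermRing {
  germ_cts : forall f, P f -> {for x, continuous f};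
  germ_near : forall f g, {near x, f =1 g} -> P f -> P g;
  germ_cst : forall c, P (fun=> c);
  germD : forall f g, P f -> P g -> P (fun y => f y + g y);
  germM : forall f g, P f -> P g -> P (fun y => f y * g y);
  germV : forall f, P f -> f x != 0 -> P (fun y => (f y)^-1)
}.

Definition germ_mx (R : realType) (X : Type) (P : (X -> R) -> Prop) m n
    (F : X -> 'M[R]_(m, n)) : Prop :=
  forall i j, P (fun y => F y i j).

Section GermRing.
Variables (R : realType) (X : topologicalType) (x : X) (P : (X -> R) -> Prop).
Hypothesis gP : germ_ring x P.

Lemma germ_neq0 f : P f -> f x != 0 -> \forall y \near x, f y != 0.
Proof.
move=> Pf f0; have fc := germ_cts gP Pf; apply: (fc [set z | z != 0]).
exact: (open_nbhs_nbhs (conj (@open_neq R 0) f0)).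
Qed.

Lemma germ_sum (I : Type) (s : seq I) (Q : pred I) (f : I -> X -> R) :
  (forall i, Q i -> P (f i)) -> P (fun y => \sum_(i <- s | Q i) f i y).
Proof.
move=> Pf; elim: s => [|i s IH].
  by under eq_fun do rewrite big_nil; exact: germ_cst gP _.
under eq_fun do rewrite big_cons.
case: (boolP (Q i)) => [Qi|//].
by apply: (germD gP) => //; exact: Pf.
Qed.

Lemma germ_prod (I : Type) (s : seq I) (Q : pred I) (f : I -> X -> R) :
  (forall i, Q i -> P (f i)) -> P (fun y => \prod_(i <- s | Q i) f i y).
Proof.
move=> Pf; elim: s => [|i s IH].
  by under eq_fun do rewrite big_nil; exact: germ_cst gP _.
under eq_fun do rewrite big_cons.
case: (boolP (Q i)) => [Qi|//].
by apply: (germM gP) => //; exact: Pf.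
Qed.

Lemma germ_mx_near m n (F G : X -> 'M[R]_(m, n)) :
  {near x, F =1 G} -> germ_mx P F -> germ_mx P G.
Proof.
move=> FG PF i j; apply: (germ_near gP) (PF i j).
by apply: filterS FG => y ->.
Qed.

Lemma germ_mx_cst m n (C : 'M[R]_(m, n)) : germ_mx P (fun=> C).
Proof. by move=> i j; exact: germ_cst gP _. Qed.

Lemma germ_mxM m n p (F : X -> 'M[R]_(m, n)) (G : X -> 'M[R]_(n, p)) :
  germ_mx P F -> germ_mx P G -> germ_mx P (fun y => F y *m G y).
Proof.
move=> PF PG i j; under eq_fun do rewrite mxE.
by apply: germ_sum => k _; exact: germM gP _ _ (PF i k) (PG k j).
Qed.

Lemma germ_mxT m n (F : X -> 'M[R]_(m, n)) :
  germ_mx P F -> germ_mx P (fun y => (F y)^T).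
Proof. by move=> PF i j; under eq_fun do rewrite mxE; exact: PF. Qed.

Lemma germ_mxZ m n (f : X -> R) (F : X -> 'M[R]_(m, n)) :
  P f -> germ_mx P F -> germ_mx P (fun y => f y *: F y).
Proof.
by move=> Pf PF i j; under eq_fun do rewrite mxE; exact: germM gP _ _ Pf (PF i j).
Qed.

Lemma germ_mx_sum (I : Type) (s : seq I) (Q : pred I) m n
    (F : I -> X -> 'M[R]_(m, n)) :
  (forall i, Q i -> germ_mx P (F i)) ->
  germ_mx P (fun y => \sum_(i <- s | Q i) F i y).
Proof.
move=> PF i j; under eq_fun do rewrite summxE.
by apply: germ_sum => k Qk; exact: PF.
Qed.

Lemma germ_det n (F : X -> 'M[R]_n) : germ_mx P F -> P (fun y => \det (F y)).
Proof.
move=> PF; under eq_fun do rewrite /determinant.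
apply: germ_sum => s _; apply: (germM gP); first exact: germ_cst gP _.
by apply: germ_prod => i _; exact: PF.
Qed.

Lemma germ_mx_unit n (F : X -> 'M[R]_n) : germ_mx P F -> F x \in unitmx ->
  \forall y \near x, F y \in unitmx.
Proof.
move=> PF Fx; have := germ_neq0 (germ_det PF); rewrite -unitfE -unitmxE => /(_ Fx).
by apply: filterS => y; rewrite -unitfE -unitmxE.
Qed.

(** Cramer's rule: the entries are cofactors divided by the determinant. The formula agrees with
    [invmx] only at invertible matrices, hence the passage to a neighbourhood where the determinant
    is nonzero. *)
Lemma germ_invmx n (F : X -> 'M[R]_n) : germ_mx P F -> F x \in unitmx ->
  germ_mx P (fun y => invmx (F y)).
Proof.
move=> PF Fx.
apply: (@germ_mx_near _ _ (fun y => (\det (F y))^-1 *: \adj (F y))).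
  by apply: filterS (germ_mx_unit PF Fx) => y Fy; rewrite /invmx Fy.
apply: germ_mxZ; first by apply: (germV gP (germ_det PF)); rewrite -unitfE -unitmxE.
move=> i j; under eq_fun do rewrite mxE /cofactor.
apply: (germM gP); first exact: germ_cst gP _.
apply: germ_det => k l; under eq_fun do rewrite !mxE.
exact: PF.
Qed.

End GermRing.

Lemma continuous_germ_ring (R : realType) (X : topologicalType) (x : X) :
  @germ_ring R X x (fun f => {for x, continuous f}).
Proof.
split=> //.
- move=> f g fg fc; have fgx : f x = g x by exact: nbhs_singleton fg.
  rewrite /prop_for /continuous_at -fgx.
  by apply: cvg_trans fc; apply: near_eq_cvg.
- by move=> c; exact: cvg_cst.
- by move=> f g fc gc; apply: cvgD.
- by move=> f g fc gc; apply: cvgM.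
- by move=> f fc f0; apply: cvgV.
Qed.

Section AtlasSmoothAt.
Variables (R : realType) (S : topologicalType) (n : nat).
Variable A : set (chart R S n).
Hypothesis chA : forall c, A c -> is_chart c.
Hypothesis covA : forall x, exists2 c, A c & chart_dom c x.

Definition atlas_smooth_at (x : S) (f : S -> R) : Prop :=
  forall c, A c -> chart_dom c x ->
    exists2 W, open_nbhs (chart_map c x) W & forall k, Sk k W (f \o chart_inv c).

Lemma atlas_smooth_at_continuous x f : atlas_smooth_at x f -> {for x, continuous f}.
Proof.
move=> fs; have [c Ac cx] := covA x.
have [W [oW Wx] SW] := fs c Ac cx.
have cc := chA Ac.
have h1 := Sk_continuous (SW 0%N) Wx.
have h2 := continuous_comp (chart_map_cts cc cx) h1.
apply: (@germ_near _ _ _ _ (continuous_germ_ring R x)) h2.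
by apply: filterS (chart_dom_nbhs cc cx) => y cy /=; rewrite chart_mapK.
Qed.

Lemma atlas_smooth_at_germ_ring x : germ_ring x (atlas_smooth_at x).
Proof.
split.
- exact: atlas_smooth_at_continuous.
- move=> f g fg fs c Ac cx; have [W [oW Wx] SW] := fs c Ac cx.
  have [W' [oW' W'x] sW'] :=
    nbhs_open_nbhs (chart_inv_near (chA Ac) cx fg).
  exists (W `&` W') => [|k]; first by split; [exact: openI|].
  apply: (@Sk_ext _ _ _ _ (f \o chart_inv c)); first exact: openI.
    by move=> z [_ /sW'].
  by apply: Sk_sub (SW k) => z [].
- by move=> c d _ _; exists setT => [|k]; [split; [exact: openT|]|exact: Sk_cst].
- move=> f g fs gs c Ac cx; have [W [oW Wx] SW] := fs c Ac cx.
  have [W' [oW' W'x] SW'] := gs c Ac cx.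
  exists (W `&` W') => [|k]; first by split; [exact: openI|].
  by apply: SkD; [exact: openI|apply: Sk_sub (SW k) => z []|
                  apply: Sk_sub (SW' k) => z []].
- move=> f g fs gs c Ac cx; have [W [oW Wx] SW] := fs c Ac cx.
  have [W' [oW' W'x] SW'] := gs c Ac cx.
  exists (W `&` W') => [|k]; first by split; [exact: openI|].
  by apply: SkM; [exact: openI|apply: Sk_sub (SW k) => z []|
                  apply: Sk_sub (SW' k) => z []].
- move=> f fs f0 c Ac cx; have [W [oW Wx] SW] := fs c Ac cx.
  have cc := chA Ac.
  have fn0 : \forall y \near x, f y != 0.
    have fc := atlas_smooth_at_continuous fs; apply: (fc [set z | z != 0]).
    exact: (open_nbhs_nbhs (conj (@open_neq R 0) f0)).
  have [W' [oW' W'x] sW'] := nbhs_open_nbhs (chart_inv_near cc cx fn0).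
  exists (W `&` W') => [|k]; first by split; [exact: openI|].
  apply: (@SkV _ _ _ _ (f \o chart_inv c)); first exact: openI.
    by move=> z [_ /sW'].
  by apply: Sk_sub (SW k) => z [].
Qed.

End AtlasSmoothAt.

Section SmoothAt.
Variables (R : realType) (M : manifold R).

Definition smooth_at : M -> (M -> R) -> Prop := atlas_smooth_at (@atlas R M).

Lemma smooth_at_continuous x f : smooth_at x f -> {for x, continuous f}.
Proof.
by apply: atlas_smooth_at_continuous; [exact: atlas_is_chart|exact: atlas_covers].
Qed.

Lemma smooth_at_germ_ring x : germ_ring x (smooth_at x).
Proof.
by apply: atlas_smooth_at_germ_ring; [exact: atlas_is_chart|exact: atlas_covers].
Qed.

Lemma smooth_at_flat x p f : smooth_at x f -> smooth_at x (fun y => flat p (f y)).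
Proof.
move=> fs c Ac cx; have [W [oW Wx] SW] := fs c Ac cx.
by exists W => // k; exact: Sk_flat (SW k).
Qed.

Lemma smooth_at_chart x c j : @atlas R M c -> chart_dom c x ->
  smooth_at x (fun y => chart_map c y 0 j).
Proof.
move=> Ac cx d Ad dx; have [cc cd] := (atlas_is_chart Ac, atlas_is_chart Ad).
have N1 := chart_inv_near cd dx (chart_dom_nbhs cc cx).
have N2 : nbhs (chart_map d x) (chart_map d @` chart_dom d).
  by apply: open_nbhs_nbhs; split; [exact: chart_img_open|exists x].
have [W [oW Wx] sW] := nbhs_open_nbhs (filterI N1 N2).
exists W => // k.
have CW := atlas_compatible (manifold_smooth M) Ad Ac.
have CW' : Cinfty W (chart_map c \o chart_inv d).
  move=> l; apply: Ck_sub (CW l) => z /sW [/= cz [y dy yz]].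
  by exists y => //; split=> //; rewrite -yz chart_mapK in cz.
by have /(CinftyP _ oW) := CW'; apply.
Qed.

End SmoothAt.

Section AtlasSmoothComp.
Variables (R : realType) (S T : topologicalType) (m n : nat).
Variables (A : set (chart R S m)) (B : set (chart R T n)).
Hypothesis chA : forall c, A c -> is_chart c.
Hypothesis chB : forall c, B c -> is_chart c.

Lemma smooth_pt_coord (x : S) (f : S -> T) : {for x, continuous f} ->
  (forall d, B d -> chart_dom d (f x) ->
    forall j, atlas_smooth_at A x (fun y => chart_map d (f y) 0 j)) ->
  smooth_pt A B x f.
Proof.
move=> fc fs; split=> // c d Ac Bd cx dx.
have /choice [W WP] : forall j, exists W, open_nbhs (chart_map c x) W /\
    forall k, Sk k W (fun z => (chart_map d \o f \o chart_inv c) z 0 j).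
  by move=> j; have [W ? ?] := fs d Bd dx j c Ac cx; exists W.
have nW : \forall z \near chart_map c x, forall j, W j z.
  have H j : nbhs (chart_map c x) (W j) by have [oW _] := WP j; exact: open_nbhs_nbhs.
  exact: (@filter_forall _ _ W _ (nbhs_filter _) H).
move: nW => /nbhs_open_nbhs [W' oW' sW']; exists W' => //.
apply/CinftyP; first by case: oW'.
by move=> j k; apply: (@Sk_sub _ _ _ (W j)) => [z /sW'//|]; case: (WP j).
Qed.

Hypothesis covB : forall x, exists2 c, B c & chart_dom c x.

Lemma atlas_smooth_at_comp (x : S) (f : S -> T) (g : T -> R) :
  smooth_pt A B x f -> atlas_smooth_at B (f x) g -> atlas_smooth_at A x (g \o f).
Proof.
move=> [fc fs] gs c Ac cx; have [e Ae ex] := covB (f x).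
have [cc ce] := (chA Ac, chB Ae).
have [W [oW Wx] CW] := fs c e Ac Ae cx ex.
have [W' [oW' W'x] SW'] := gs e Ae ex.
have fe : nbhs x (fun y => chart_dom e (f y)).
  by apply: fc; exact: chart_dom_nbhs ce ex.
have N1 := chart_inv_near cc cx fe.
have N2 : nbhs (chart_map c x)
    ((chart_map e \o f \o chart_inv c) @^-1` W').
  apply: (Cinfty_continuous CW Wx).
  by rewrite /= (chart_mapK cc)//; exact: open_nbhs_nbhs.
have [W1 [oW1 W1x] sW1] := nbhs_open_nbhs (filterI (open_nbhs_nbhs (conj oW Wx))
  (filterI N1 N2)).
exists W1 => // k.
apply: (@Sk_ext _ _ _ _ ((g \o chart_inv e) \o
    (chart_map e \o f \o chart_inv c))) => //.
  by move=> z /sW1 [_ [/= ez _]]; rewrite (chart_mapK ce).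
apply: (@Sk_comp _ _ _ _ _ W') => //.
- by move=> a /sW1 [_ []].
- move=> i; apply: (@Sk_sub _ _ _ W) => [z /sW1 []//|].
  by have /(CinftyP _ oW) := CW; apply.
Qed.

End AtlasSmoothComp.

Lemma smooth_at_comp (R : realType) (M N : manifold R) (x : M) (f : M -> N)
    (g : N -> R) :
  smooth_pt (@atlas R M) (@atlas R N) x f -> smooth_at (f x) g ->
  smooth_at x (g \o f).
Proof.
apply: atlas_smooth_at_comp; [exact: atlas_is_chart|exact: atlas_is_chart|].
exact: atlas_covers.
Qed.

Section TrivAtlas.
Variables (R : realType) (M : manifold R) (r : nat).
Implicit Types (x : M) (w : 'rV[R]_r).

Definition triv_smooth_at : (M * 'rV[R]_r)%type -> (M * 'rV[R]_r -> R) -> Prop :=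
  atlas_smooth_at (@triv_atlas R M r).

Lemma triv_smooth_at_germ_ring z : germ_ring z (triv_smooth_at z).
Proof.
apply: atlas_smooth_at_germ_ring; [exact: triv_atlas_is_chart|].
exact: triv_atlas_covers.
Qed.

Lemma triv_smooth_at_fst z (f : M -> R) :
  smooth_at z.1 f -> triv_smooth_at z (fun y => f y.1).
Proof.
move=> fs _ [c Ac [d -> <-]] /= [cx _]; have [W [oW Wx] SW] := fs c Ac cx.
have oW' : open ((lsubmx : 'rV[R]_(manifold_dim M + r) -> _) @^-1` W).
  by apply: open_comp => // u _; exact: continuous_lsubmx.
exists (lsubmx @^-1` W) => [|k]; first by split; rewrite //= row_mxKl.
apply: (@Sk_comp _ _ _ _ _ W lsubmx (f \o chart_inv c)) => // j.
apply: (@Sk_ext _ _ _ _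
  (fun u : 'rV[R]_(manifold_dim M + r) => u 0 (lshift r j))) => //.
  by move=> u _; rewrite mxE.
exact: Sk_coord.
Qed.

Lemma triv_smooth_at_snd z j : triv_smooth_at z (fun y => y.2 0 j).
Proof.
move=> _ [c Ac [d -> <-]] /= _.
exists setT => [|k]; first by split => //; exact: openT.
apply: (@Sk_ext _ _ _ _ (fun u : 'rV[R]_(manifold_dim M + r) =>
  u 0 (rshift (manifold_dim M) j))); first exact: openT.
  by move=> u _; rewrite /= mxE.
exact: Sk_coord.
Qed.

Lemma smooth_pt_slice x w :
  smooth_pt (@atlas R M) (@triv_atlas R M r) x (fun y => (y, w)).
Proof.
have gx := smooth_at_germ_ring x.
apply: smooth_pt_coord.
  have h1 : {for x, continuous (@id M)} by exact: cvg_id.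
  have h2 : {for x, continuous (fun=> w)} by exact: cvg_cst.
  exact: cvg_pair h1 h2.
move=> _ [c Ac [d -> <-]] /= [cx _] j.
rewrite (_ : (fun y => _) = (fun y => match fintype.split j with
  inl i => chart_map c y 0 i | inr i => w 0 i end)); last first.
  by apply/funext => y; rewrite mxE.
case: fintype.split => i; first exact: smooth_at_chart.
exact: (germ_cst gx).
Qed.

End TrivAtlas.

(** * Partitions of unity *)

Section PartitionOfUnity.
Variables (R : realType) (M : manifold R).
Implicit Types (x y : M) (O : set M).

(** In a chart, apply [flat 0] to the squared radius [d ^+ 2] minus the squared distance to the
    centre, and extend by 0. The result vanishes off the image [C] of a closed box; [C] is compact,
    hence closed because [M] is Hausdorff, and this makes the extension smooth. *)
Lemma bump x O : nbhs x O -> exists b : M -> R,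
  [/\ forall y, smooth_at y b, forall y, 0 <= b y, 0 < b x
    & forall y, ~ O y -> \forall z \near y, b z = 0].
Proof.
move=> Ox; have [c Ac cx] := atlas_covers x.
have cc := atlas_is_chart Ac.
pose z0 := chart_map c x.
have N1 := chart_inv_near cc cx Ox.
have N2 : nbhs z0 (chart_map c @` chart_dom c).
  by apply: open_nbhs_nbhs; split; [exact: chart_img_open|exists x].
have [e /= e0 eN] := (nbhs_ballP _ _).1 (filterI N1 N2).
pose d := e / 2; have d0 : 0 < d by rewrite divr_gt0.
pose K := [set z : 'rV[R]_(manifold_dim M) |
  forall i, `[z0 0 i - d, z0 0 i + d]%classic (z 0 i)].
have Kz z : K z -> (chart_map c @` chart_dom c) z /\ O (chart_inv c z).
  move=> Kz; have [] := eN z; last by [].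
    split=> // i j; rewrite ord1 -ball_normE /= ltr_distlC.
    by have := Kz j; rewrite /= in_itv /= /d => /andP[? ?]; apply/andP; split; lra.
have cK : compact K.
  have := @rV_compact R _ (fun i => `[z0 0 i - d, z0 0 i + d]%classic).
  by apply=> i; exact: segment_compact.
pose C := chart_inv c @` K.
have clC : closed C.
  apply: compact_closed; first exact: manifold_hausdorff.
  apply: continuous_compact => //.
  apply: continuous_subspaceW (chart_inv_continuous cc).
  by move=> z /Kz [].
have CP y : C y -> chart_dom c y /\ O y.
  by move=> [z /Kz[[y' cy' <-] Oz] <-]; rewrite chart_mapK in Oz *.
pose q y := d ^+ 2 - \sum_j (chart_map c y 0 j - z0 0 j) ^+ 2.
pose b y := if `[< chart_dom c y >] then flat 0 (q y) else 0.
have bC y : ~ C y -> b y = 0.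
  rewrite /b; case: asboolP => // cy nC; apply: flat_le0; rewrite leNgt.
  apply/negP => qy; apply: nC; exists (chart_map c y); last exact: chart_mapK.
  move=> i; rewrite /= in_itv /= -ler_distlC distrC.
  rewrite -(@ler_pXn2r _ 2)// ?nnegrE ?(ltW d0)//.
  rewrite real_normK ?num_real//.
  move: qy; rewrite /q subr_gt0 => /ltW; apply: le_trans.
  by rewrite (bigD1 i)//= lerDl sumr_ge0// => j _; rewrite sqr_ge0.
have bnC y : ~ C y -> \forall z \near y, b z = 0.
  move=> nC; have : nbhs y (~` C).
    by apply: open_nbhs_nbhs; split => //; exact: closed_openC.
  by apply: filterS => z /bC.
exists b; split.
- move=> y; have gy := smooth_at_germ_ring y.
  have [/CP[cy _]|nC] := pselect (C y); last first.
    apply: (germ_near gy) (germ_cst gy 0).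
    by apply: filterS (bnC y nC) => z ->.
  apply: (@germ_near _ _ _ _ gy (fun z => flat 0 (q z))).
    by apply: filterS (chart_dom_nbhs cc cy) => z cz; rewrite /b asboolT.
  apply: smooth_at_flat; apply: (germD gy); first exact: germ_cst gy _.
  under eq_fun do rewrite -mulN1r.
  apply: (germM gy); first exact: germ_cst gy _.
  apply: (germ_sum gy) => j _; under eq_fun do rewrite expr2.
  have H : smooth_at y (fun z => chart_map c z 0 j - z0 0 j).
    by apply: (germD gy); [exact: smooth_at_chart|exact: germ_cst gy _].
  exact: (germM gy).
- by move=> y; rewrite /b; case: ifP => // _; exact: flat_ge0.
- rewrite /b asboolT//; apply: flat_gt0; rewrite /q big1 ?subr0 ?exprn_gt0// => j _.
  by rewrite subrr expr0n.
- by move=> y nO; apply: bnC => /CP[].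
Qed.

(** Each basic open set contained in some [O x] selects one such [x]; the indices that no such set
    carries receive the default [x0]. *)
Lemma lindelof (x0 : M) (O : M -> set M) : (forall x, nbhs x (O x)) ->
  exists s : nat -> M, forall y, exists n, O (s n) y.
Proof.
move=> nO; have [B /countable_injP [f finj] [_ bB]] := manifold_second_countable M.
pose s n := xget x0 [set x | exists2 b, B b & f b = n /\ b `<=` O x].
exists s => y; have [b [Bb by_] bO] := bB y _ (nO y).
exists (f b); rewrite /s; case: xgetP => [x _ [b' Bb' [eqf sub]]|/(_ y) []].
  have eqb : b' = b by apply: finj => //; rewrite inE.
  by apply: sub; rewrite eqb.
by exists b.
Qed.

(* The sum of the [rho n] is positive but is not normalized to be 1. *)
Record smooth_partition (O : M -> set M) (s : nat -> M)
    (rho : nat -> M -> R) : Prop := IsPartition {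
  spart_smooth : forall n x, smooth_at x (rho n);
  spart_ge0 : forall n x, 0 <= rho n x;
  spart_gt0 : forall x, exists n, 0 < rho n x;
  spart_fin : forall x, exists N, \forall y \near x,
    forall n, (N <= n)%N -> rho n y = 0;
  spart_supp : forall n x, ~ O (s n) x -> \forall y \near x, rho n y = 0
}.

Lemma smooth_partition_exists (x0 : M) (O : M -> set M) : (forall x, nbhs x (O x)) ->
  exists s rho, smooth_partition O s rho.
Proof.
move=> nO; have /choice [b bP] := fun x => bump (nO x).
have nb x : nbhs x [set y | 0 < b x y].
  have [bs _ bx _] := bP x; have bc := smooth_at_continuous (bs x).
  apply: (bc [set z | 0 < z]).
  exact: (open_nbhs_nbhs (conj (@open_gt R 0) bx)).
have [s sP] := lindelof x0 nb.
(* The [j]-th factor vanishes where [b (s j)] exceeds [1 / (n + 1)]; this gives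
   local finiteness without an exhaustion by compact sets. *)
pose rho n y := b (s n) y * \prod_(j < n) flat 0 (n.+1%:R^-1 - b (s j) y).
have b_ge0 n y : 0 <= b (s n) y by have [_] := bP (s n).
have b_smooth n y : smooth_at y (b (s n)) by have [] := bP (s n).
exists s, rho; split.
- move=> n y; have gy := smooth_at_germ_ring y.
  apply: (germM gy); first exact: b_smooth.
  apply: (germ_prod gy) => j _; apply: smooth_at_flat.
  apply: (germD gy); first exact: germ_cst gy _.
  under eq_fun do rewrite -mulN1r.
  by apply: (germM gy); [exact: germ_cst gy _|exact: b_smooth].
- by move=> n y; rewrite mulr_ge0// prodr_ge0// => j _; exact: flat_ge0.
- move=> y; have exn : exists n, 0 < b (s n) y by exact: sP.
  (* For the least such [n] the earlier bumps vanish at [y], so every factor is [flat 0] at the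
     positive number [1 / (n + 1)]. *)
  case: (ex_minnP exn) => n bn nmin; exists n; rewrite mulr_gt0//.
  apply: prodr_gt0 => j _; apply: flat_gt0.
  have -> : b (s j) y = 0; last by rewrite subr0.
  apply/eqP; rewrite eq_le b_ge0 andbT leNgt; apply/negP => /nmin.
  by rewrite leqNgt ltn_ord.
- move=> y; have [j bj] := sP y; rewrite /= in bj.
  (* Halving leaves room: [b (s j)] still exceeds [1 / (N + 1)] on a whole neighbourhood of [y].
     There the [j]-th factor vanishes for every [n >= N] in whose product it occurs, that is for
     [n > j]. *)
  have [N NP] : exists N, N.+1%:R^-1 < b (s j) y / 2.
    have h0 : 0 < b (s j) y / 2 by rewrite divr_gt0.
    have [N _ NP] := near_infty_natSinv_lt (PosNum h0).
    by exists N; exact: (NP N (leqnn N)).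
  exists (maxn j.+1 N).
  have : \forall z \near y, b (s j) y / 2 < b (s j) z.
    have bc := smooth_at_continuous (b_smooth j y).
    apply: (bc [set z | _ < z]).
    apply: (open_nbhs_nbhs (conj (@open_gt R _) _)) => /=.
    by rewrite ltr_pdivrMr// ltr_pMr// ltr1n.
  apply: filterS => z bz n; rewrite geq_max => /andP[jn Nn].
  rewrite /rho (bigD1 (Ordinal jn))//= flat_le0 ?mul0r ?mulr0// subr_le0.
  apply: le_trans (ltW bz); apply: le_trans (ltW NP).
  by rewrite lef_pV2 ?posrE// ler_nat.
- move=> n y nOy; have [_ _ _ /(_ y nOy)] := bP (s n).
  by apply: filterS => z bz; rewrite /rho bz mul0r.
Qed.

End PartitionOfUnity.

(** * Positive definite matrices *)

(** Only the symmetric part of [X] is constrained, so this is a convex condition on arbitrary square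
    matrices and applies to products such as [P *m X]. *)
Definition posdef (R : realType) n (X : 'M[R]_n) : Prop :=
  forall v : 'rV[R]_n, v != 0 -> 0 < (v *m X *m v^T) 0 0.

Section PositiveDefinite.
Variables (R : realType) (n : nat).
Implicit Types (X P : 'M[R]_n) (v : 'rV[R]_n).

Lemma mulmx_row_trE v : (v *m v^T) 0 0 = \sum_i v 0 i ^+ 2.
Proof. by rewrite mxE; apply: eq_bigr => i _; rewrite mxE expr2. Qed.

Lemma posdef1 : posdef (1%:M : 'M[R]_n).
Proof.
move=> v v0; rewrite mulmx1 mulmx_row_trE lt_def sumr_ge0 ?andbT; last first.
  by move=> i _; exact: sqr_ge0.
apply: contra v0; rewrite psumr_eq0 => [/allP v2|i _]; last exact: sqr_ge0.
apply/eqP/rowP => i; rewrite mxE; apply/eqP.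
by have := v2 i (mem_index_enum _); rewrite /= sqrf_eq0.
Qed.

(** A nonzero row killed by [P] would annihilate the form. This is how invertibility, which is not
    preserved by sums, is obtained from a condition that is. *)
Lemma posdef_unitl X P : posdef (P *m X) -> P \in unitmx.
Proof.
move=> pX; rewrite -row_free_unit -kermx_eq0; apply: contraT => /rowV0Pn.
move=> [v /sub_kermxP vP0 v0]; have := pX v v0.
by rewrite mulmxA vP0 !mul0mx mxE ltxx.
Qed.

Lemma posdef_unit X : posdef X -> X \in unitmx.
Proof. by move=> pX; apply: (@posdef_unitl 1%:M); rewrite mulmx1. Qed.

Lemma posdefZ (c : R) X : 0 < c -> posdef X -> posdef (c *: X).
Proof.
move=> c0 pX v v0; rewrite -scalemxAr -scalemxAl mxE mulr_gt0//; exact: pX.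
Qed.

Lemma posdef_sum (N : nat) (F : nat -> 'M[R]_n) (c : nat -> R) :
  (forall i, 0 <= c i) -> (forall i, 0 < c i -> posdef (F i)) ->
  (exists2 i, (i < N)%N & 0 < c i) -> posdef (\sum_(i < N) c i *: F i).
Proof.
move=> c0 pF [k kN ck] v v0.
rewrite mulmx_sumr mulmx_suml summxE (bigD1 (Ordinal kN))//=.
have pos i : 0 <= (v *m (c i *: F i) *m v^T) 0 0.
  have := c0 i; rewrite le_eqVlt => /orP[/eqP <-|ci].
    by rewrite scale0r mulmx0 mul0mx mxE.
  by apply: ltW; apply: posdefZ => //; exact: pF.
apply: ltr_wpDr; last by apply: posdefZ => //; exact: pF.
by apply: sumr_ge0 => i _; exact: pos.
Qed.

Lemma posdef_conj X P : P \in unitmx -> posdef X -> posdef (P *m X *m P^T).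
Proof.
move=> uP pX v v0; have := pX (v *m P).
rewrite trmx_mul !mulmxA; apply.
by apply: contra v0 => /eqP vP; rewrite -[v](mulmxK uP) vP mul0mx.
Qed.

(** By the arithmetic-geometric mean inequality, entrywise errors of at most [d] perturb the form by
    at most [d * n] times the squared length. The choice [d = 1 / (n + 1)] makes [d * n] smaller
    than 1. *)
Lemma posdef_near1 (X : 'M[R]_n) :
  (forall i j, `|X i j - (i == j)%:R| <= n.+1%:R^-1) -> posdef X.
Proof.
move=> X1 v v0; set d : R := n.+1%:R^-1 in X1.
have -> : (v *m X *m v^T) 0 0 = \sum_i v 0 i ^+ 2 +
    \sum_i \sum_j v 0 i * v 0 j * (X i j - (i == j)%:R).
  rewrite -mulmx_row_trE -[X in _ *m X *m _](subrK 1%:M) mulmxDr mulmxDl mulmx1.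
  rewrite mxE addrC; congr (_ + _); rewrite mxE exchange_big /=.
  apply: eq_bigr => j _; rewrite !mxE big_distrl /=; apply: eq_bigr => i _.
  by rewrite !mxE mulrAC.
have S0 : 0 < \sum_i v 0 i ^+ 2.
  by rewrite -mulmx_row_trE -[v in v *m _]mulmx1; exact: posdef1.
set S := \sum_i v 0 i ^+ 2 in S0 *.
have : `|\sum_i \sum_j v 0 i * v 0 j * (X i j - (i == j)%:R)| <= d * n%:R * S.
  apply: le_trans (ler_norm_sum _ _ _) _.
  apply: (@le_trans _ _ (\sum_i \sum_j (v 0 i ^+ 2 + v 0 j ^+ 2) / 2 * d)).
    apply: ler_sum => i _; apply: le_trans (ler_norm_sum _ _ _) _.
    apply: ler_sum => j _; rewrite !normrM; apply: ler_pM => //.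
    rewrite -(@real_normK _ (v 0 i)) ?num_real// -(@real_normK _ (v 0 j)) ?num_real//.
    have := sqr_ge0 (`|v 0 i| - `|v 0 j|); nra.
  under eq_bigr do rewrite -big_distrl -big_distrl big_split /= sumr_const card_ord.
  rewrite -big_distrl -big_distrl big_split /= sumr_const card_ord -/S.
  rewrite sumrMnl -/S -mulr2n -[_ *+ 2]mulr_natr mulfK ?pnatr_eq0//.
  by rewrite -[S *+ n]mulr_natl mulrC mulrA.
have : d * n%:R < 1 by rewrite mulrC ltr_pdivrMr// mul1r ltr_nat.
rewrite ler_norml => dn /andP[lb _].
have : d * n%:R * S < S by rewrite gtr_pMl.
lra.
Qed.

End PositiveDefinite.

(** * The pairings between nearby fibres *)

Lemma sum_widen (V : nmodType) (F : nat -> V) (m n : nat) :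
  (forall i, (m <= i)%N -> F i = 0) -> (forall i, (n <= i)%N -> F i = 0) ->
  \sum_(i < m) F i = \sum_(i < n) F i.
Proof.
wlog mn : m n / (m <= n)%N => [H Fm Fn|Fm _].
  by case/orP: (leq_total m n) => ?; [exact: H|symmetry; exact: H].
rewrite -!(big_mkord xpredT) [RHS](@big_cat_nat _ _ _ m)//=.
rewrite [X in _ + X]big1_seq ?addr0// => i.
by rewrite mem_index_iota => /andP[_ /andP[/Fm]].
Qed.

Lemma invmx_eq (R : comUnitRingType) n (A B : 'M[R]_n) :
  A *m B = 1%:M -> invmx A = B.
Proof.
move=> AB; have [uA _] := mulmx1_unit AB.
by rewrite -[LHS]mulmx1 -AB mulKmx.
Qed.

Lemma invmxM (R : comUnitRingType) n (A B : 'M[R]_n) :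
  A \in unitmx -> B \in unitmx -> invmx (A *m B) = invmx B *m invmx A.
Proof.
by move=> uA uB; apply: invmx_eq; rewrite mulmxA mulmxK// mulmxV.
Qed.

(* Trivializations are indexed by the points of [M]. The one indexed by [x]
   provides the frame of the fibre over [x], so that linear maps between fibres
   are plain matrices. These frames do not vary continuously: [G a x x]
   translates from the frame of trivialization [a] to that at [x], and
   continuity and smoothness are only meaningful after this translation. *)
Record cocycle (R : realType) (M : manifold R) (r : nat) (U : M -> set M)
    (G : M -> M -> M -> 'M[R]_r) : Prop := IsCocycle {
  coc_open : forall a, open (U a);
  coc_in : forall a, U a a;
  coc_smooth : forall a b x, U a x -> U b x -> germ_mx (smooth_at x) (G a b);
  coc_comp : forall a b c x, U a x -> U b x -> U c x ->
    G a b x *m G b c x = G a c x;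
  coc_id : forall a x, U a x -> G a a x = 1%:M
}.

Section Cocycle.
Variables (R : realType) (M : manifold R) (r : nat) (U : M -> set M).
Variable G : M -> M -> M -> 'M[R]_r.
Hypothesis cG : cocycle U G.

Lemma coc_nbhs a x : U a x -> nbhs x (U a).
Proof. by move=> Ux; apply: open_nbhs_nbhs; split=> //; exact: coc_open cG a. Qed.

Lemma coc_inv a b x : U a x -> U b x -> G a b x *m G b a x = 1%:M.
Proof. by move=> ax bx; rewrite (coc_comp cG)// (coc_id cG). Qed.

Lemma coc_unit a b x : U a x -> U b x -> G a b x \in unitmx.
Proof. by move=> ax bx; case: (mulmx1_unit (coc_inv ax bx)). Qed.

Lemma coc_cts (X : topologicalType) (f : X -> M) (x : X) a b :
  {for x, continuous f} -> U a (f x) -> U b (f x) ->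
  germ_mx (fun h => {for x, continuous h}) (fun y => G a b (f y)).
Proof.
move=> fc ax bx i j; have H := smooth_at_continuous (coc_smooth cG ax bx i j).
exact: (@continuous_comp _ _ _ f (fun y => G a b y i j)).
Qed.

(** The matrix, in the frames of [a] and [b], of the pairing between the fibres over [f x] and [g x]
    that [K x] describes in the frames belonging to these two points. *)
Definition pair_rep (X : Type) (f g : X -> M) (K : X -> 'M[R]_r) (a b : M)
    (x : X) : 'M[R]_r :=
  G a (f x) (f x) *m K x *m (G b (g x) (g x))^T.

Definition pair_cts (X : topologicalType) (x : X) (f g : X -> M)
    (K : X -> 'M[R]_r) : Prop :=
  forall a b, U a (f x) -> U b (g x) ->
    germ_mx (fun h => {for x, continuous h}) (pair_rep f g K a b).

Variables (s : nat -> M) (rho : nat -> M -> R).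
Hypothesis rhoP : smooth_partition U s rho.

Lemma part_neq0 n x : rho n x != 0 -> U (s n) x.
Proof.
move=> /eqP r0; apply: contrapT => nU; apply: r0.
exact: (nbhs_singleton (spart_supp rhoP nU)).
Qed.

Lemma part_ex_fin x : exists N, forall n, (N <= n)%N -> rho n x = 0.
Proof. by have [N /nbhs_singleton] := spart_fin rhoP x; exists N. Qed.

Definition part_bound x : nat := projT1 (cid (part_ex_fin x)).

Lemma part_boundP x n : (part_bound x <= n)%N -> rho n x = 0.
Proof. by move: n; rewrite /part_bound; case: cid. Qed.

(** The cut-off [part_bound x] is an arbitrary choice at each point; the omitted terms vanish
    because they contain [rho n x]. *)
Definition tau (x y : M) : 'M[R]_r :=
  \sum_(n < part_bound x)
    (rho n x * rho n y) *: (G x (s n) x *m (G y (s n) y)^T).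

Lemma tau_posdef x : posdef (tau x x).
Proof.
rewrite /tau; apply: (@posdef_sum _ _ _ (fun n => G x (s n) x *m (G x (s n) x)^T)
  (fun n => rho n x * rho n x)).
- by move=> n; rewrite mulr_ge0 ?(spart_ge0 rhoP).
- move=> n; rewrite lt0r mulf_eq0 negb_or => /andP[/andP[/part_neq0 Ux _] _].
  rewrite -[X in posdef (X *m _)]mulmx1; apply: posdef_conj; last exact: posdef1.
  exact: coc_unit (coc_in cG x) Ux.
- have [n rn] := spart_gt0 rhoP x; exists n; last exact: mulr_gt0.
  by rewrite ltnNge; apply/negP => /part_boundP r0; rewrite r0 ltxx in rn.
Qed.

Lemma tau_unit x : tau x x \in unitmx.
Proof. exact: posdef_unit (tau_posdef x). Qed.

(** Near [x] one cut-off [N] serves all points, and the cocycle rule absorbs the discontinuous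
    frames at [f y] and [g y]. A term whose transition matrices are not both defined at [x] has a
    coefficient vanishing nearby. *)
Lemma tau_cts (X : topologicalType) (x : X) (f g : X -> M) :
  {for x, continuous f} -> {for x, continuous g} ->
  pair_cts x f g (fun y => tau (f y) (g y)).
Proof.
move=> fc gc a b ax bx; have gR := continuous_germ_ring R x.
have [N finN] := spart_fin rhoP (f x).
apply: (@germ_mx_near _ _ _ _ gR _ _ (fun y => \sum_(n < N)
    (rho n (f y) * rho n (g y)) *: (G a (s n) (f y) *m (G b (s n) (g y))^T))).
  have Na : \forall y \near x, U a (f y) by apply: fc; exact: coc_nbhs.
  have Nb : \forall y \near x, U b (g y) by apply: gc; exact: coc_nbhs.
  have {}finN : \forall y \near x, forall n, (N <= n)%N -> rho n (f y) = 0 :=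
    fc _ finN.
  apply: filterS3 Na Nb finN => y ay by_ /= finN.
  rewrite /pair_rep /tau (@sum_widen _ (fun n => (rho n (f y) * rho n (g y)) *:
    (G (f y) (s n) (f y) *m (G (g y) (s n) (g y))^T)) (part_bound _) N); first last.
  - by move=> n /finN ->; rewrite mul0r scale0r.
  - by move=> n /part_boundP ->; rewrite mul0r scale0r.
  rewrite mulmx_sumr mulmx_suml; apply: eq_bigr => n _.
  have [->|] := eqVneq (rho n (f y) * rho n (g y)) 0.
    by rewrite !scale0r mulmx0 mul0mx.
  rewrite mulf_eq0 negb_or => /andP[/part_neq0 sf /part_neq0 sg].
  rewrite -scalemxAr -scalemxAl; congr (_ *: _).
  rewrite mulmxA -[_ *m _^T *m _^T]mulmxA -trmx_mul (coc_comp cG ay (coc_in cG _) sf).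
  by rewrite (coc_comp cG by_ (coc_in cG _) sg).
apply: (germ_mx_sum gR) => n _.
have rc h : {for x, continuous h} -> {for x, continuous (fun y => rho n (h y))}.
  move=> hc; have H := smooth_at_continuous (@spart_smooth _ _ _ _ _ rhoP n (h x)).
  exact: (@continuous_comp _ _ _ h (rho n)).
have zero : (\forall y \near x, rho n (f y) * rho n (g y) = 0) ->
    germ_mx (fun h => {for x, continuous h}) (fun y => (rho n (f y) * rho n (g y)) *:
      (G a (s n) (f y) *m (G b (s n) (g y))^T)).
  move=> r0; apply: (germ_mx_near gR) (germ_mx_cst gR 0).
  by apply: filterS r0 => y ->; rewrite scale0r.
have [sf|nsf] := pselect (U (s n) (f x)); last first.
  have Hs : \forall y \near x, rho n (f y) = 0 := fc _ (spart_supp rhoP nsf).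
  by apply: zero; apply: filterS Hs => y /= ->; rewrite mul0r.
have [sg|nsg] := pselect (U (s n) (g x)); last first.
  have Hs : \forall y \near x, rho n (g y) = 0 := gc _ (spart_supp rhoP nsg).
  by apply: zero; apply: filterS Hs => y /= ->; rewrite mulr0.
apply: (germ_mxZ gR); first by apply: (germM gR); exact: rc.
apply: (germ_mxM gR); first exact: coc_cts.
by apply: germ_mxT; exact: coc_cts.
Qed.

Lemma pair_cts_near (X : topologicalType) (x : X) (f f' g g' : X -> M)
    (K K' : X -> 'M[R]_r) :
  {near x, f =1 f'} -> {near x, g =1 g'} -> {near x, K =1 K'} ->
  pair_cts x f g K -> pair_cts x f' g' K'.
Proof.
move=> ff gg KK Kc a b; rewrite -(nbhs_singleton ff) -(nbhs_singleton gg) => ax bx.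
apply: (germ_mx_near (continuous_germ_ring R x)) (Kc a b ax bx).
by apply: filterS3 ff gg KK => y ef eg eK; rewrite /pair_rep -ef -eg -eK.
Qed.

(* [K] followed by the transport [tau g g ^-1 * tau g h] from [g] to [h]. *)
Lemma pair_cts_step (X : topologicalType) (x : X) (f g h : X -> M)
    (K : X -> 'M[R]_r) :
  {for x, continuous g} -> {for x, continuous h} -> pair_cts x f g K ->
  pair_cts x f h (fun y => K y *m invmx (tau (g y) (g y)) *m tau (g y) (h y)).
Proof.
move=> gc hc Kc a c ax cx; have gR := continuous_germ_ring R x.
pose b := g x; have bx : U b (g x) by exact: coc_in cG _.
(* Reading all three factors in the fixed frame [b] over [g y] makes each continuous; the changes of
   frame between them cancel. *)
apply: (@germ_mx_near _ _ _ _ gR _ _ (fun y => pair_rep f g K a b y *m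
  invmx (pair_rep g g (fun y => tau (g y) (g y)) b b y) *m
  pair_rep g h (fun y => tau (g y) (h y)) b c y)).
  have Nb : \forall y \near x, U b (g y) by apply: gc; exact: coc_nbhs.
  apply: filterS Nb => y by_; rewrite /pair_rep.
  set Gb := G b _ _; have uGb : Gb \in unitmx by exact: coc_unit (coc_in cG _).
  have uT := tau_unit (g y).
  have -> : invmx (Gb *m tau (g y) (g y) *m Gb^T) =
      invmx Gb^T *m invmx (tau (g y) (g y)) *m invmx Gb.
    by rewrite !invmxM ?mulmxA// ?unitmx_mul ?unitmx_tr ?uGb ?uT.
  by rewrite !mulmxA mulmxK ?unitmx_tr// mulmxKV.
have Tc := tau_cts gc gc bx bx.
apply: (germ_mxM gR); last exact: (tau_cts gc hc).
apply: (germ_mxM gR); first exact: Kc.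
apply: (germ_invmx gR) => //.
by rewrite /pair_rep !unitmx_mul unitmx_tr tau_unit (coc_unit bx (coc_in cG _)).
Qed.

(** [tau] is invertible on the diagonal and its determinant in fixed frames is continuous. In
    [good_step_near] the space [X] consists of two times and a base point. *)
Lemma tau_unit_near (X : topologicalType) (x : X) (f g : X -> M) :
  {for x, continuous f} -> {for x, continuous g} -> f x = g x ->
  \forall y \near x, tau (f y) (g y) \in unitmx.
Proof.
move=> fc gc fg; have gR := continuous_germ_ring R x.
have fx : U (f x) (f x) := coc_in cG _.
have gx : U (f x) (g x) by rewrite -fg.
have Tc := tau_cts fc gc fx gx.
have := germ_mx_unit gR Tc; rewrite /pair_rep -fg.
rewrite !unitmx_mul unitmx_tr tau_unit (coc_unit fx fx) => /(_ isT).
have Nf : \forall y \near x, U (f x) (f y) by apply: fc; exact: coc_nbhs.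
have Ng : \forall y \near x, U (f x) (g y) by apply: gc; exact: coc_nbhs.
by apply: filterS => y; rewrite !unitmx_mul => /andP[/andP[]].
Qed.

End Cocycle.

(** * Transport along the homotopy *)

(** [eps x] is the mean of the values [e (s n)] with weights [rho n x]. A mean cannot exceed all the
    values it averages, so some [p = s n] of positive weight satisfies [eps x <= e p]. This suffices
    for conditions that pass to smaller steps. *)
Lemma partition_average (R : realType) (M : manifold R) (O : M -> set M)
    (s : nat -> M) (rho : nat -> M -> R) (e : M -> R) :
  smooth_partition O s rho -> (forall x, 0 < e x) ->
  exists eps : M -> R, forall x, [/\ {for x, continuous eps}, 0 < eps x
    & exists2 p, O p x & eps x <= e p].
Proof.
move=> rhoP e0.
pose S (N : nat) y := \sum_(n < N) rho n y.
pose E (N : nat) y := \sum_(n < N) rho n y * e (s n).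
pose B := part_bound rhoP.
have SB N y : (forall n, (N <= n)%N -> rho n y = 0) -> S (B y) y = S N y.
  by apply: (@sum_widen _ (rho^~ y)) => n /part_boundP.
have EB N y : (forall n, (N <= n)%N -> rho n y = 0) -> E (B y) y = E N y.
  move=> r0; apply: (@sum_widen _ (fun n => rho n y * e (s n))) => n.
    by move=> /part_boundP ->; rewrite mul0r.
  by move=> /r0 ->; rewrite mul0r.
have pos x : exists2 n, (n < B x)%N & 0 < rho n x.
  have [n rn] := spart_gt0 rhoP x; exists n => //.
  by rewrite ltnNge; apply/negP => /part_boundP r0; rewrite r0 ltxx in rn.
have rge n x : 0 <= rho n x by exact: spart_ge0 rhoP n x.
have S0 x : 0 < S (B x) x.
  have [n nB rn] := pos x; rewrite /S (bigD1 (Ordinal nB))//=.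
  by rewrite ltr_wpDr// sumr_ge0.
exists (fun y => E (B y) y * (S (B y) y)^-1) => x; split.
- have gR := continuous_germ_ring R x.
  have [N finN] := spart_fin rhoP x.
  have SN : S N x = S (B x) x by rewrite (SB N)//; exact: nbhs_singleton finN.
  have rc n : {for x, continuous (rho n)}.
    exact: smooth_at_continuous (@spart_smooth _ _ _ _ _ rhoP n x).
  apply: (@germ_near _ _ _ _ gR (fun y => E N y * (S N y)^-1)).
    by apply: filterS finN => y finy; rewrite (EB N)// (SB N).
  apply: (germM gR).
    apply: (germ_sum gR) => n _; apply: (germM gR) => //; exact: germ_cst gR _.
  by apply: (germV gR); [exact: (germ_sum gR)|rewrite SN gt_eqF].
- rewrite divr_gt0//; have [n nB rn] := pos x; rewrite /E (bigD1 (Ordinal nB))//=.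
  rewrite ltr_wpDr// ?mulr_gt0// sumr_ge0// => i _.
  by rewrite mulr_ge0// ltW.
- apply: contrapT => no; suff : E (B x) x < E (B x) x by rewrite ltxx.
  have lt n : 0 < rho n x -> e (s n) < E (B x) x / S (B x) x.
    move=> rn; rewrite ltNge; apply/negP => le; apply: no; exists (s n) => //.
    by apply: (part_neq0 rhoP); rewrite gt_eqF.
  rewrite -[X in _ < X](divfK (lt0r_neq0 (S0 x))) mulrC [X in _ < X * _]/S.
  rewrite [X in X < _]/E mulr_suml.
  have [n nB rn] := pos x.
  rewrite (bigD1 (Ordinal nB))//= [X in _ < X](bigD1 (Ordinal nB))//=.
  apply: ltr_leD; first by rewrite ltr_pM2l// lt.
  apply: ler_sum => i _; have := rge i x; rewrite le_eqVlt => /orP[/eqP <-|ri].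
    by rewrite !mul0r.
  by rewrite ler_pM2l// ltW// lt.
Qed.

Section Chain.
Variables (R : realType) (M : manifold R) (r : nat) (U : M -> set M).
Variable G : M -> M -> M -> 'M[R]_r.
Hypothesis cG : cocycle U G.
Variables (s : nat -> M) (rho : nat -> M -> R).
Hypothesis rhoP : smooth_partition U s rho.
Variables (H : R * M -> M) (phi : M -> M).
Hypothesis Hc : continuous H.
Hypothesis H0 : forall x, H (0, x) = phi x.
Hypothesis H1 : forall t x, 1 <= t -> H (t, x) = x.

Let tau := tau G rhoP.

(** Only the starting time is confined to the compact interval: [u] may exceed 1, as the end of the
    last step usually does. *)
Definition good_step (x : M) (e : R) : Prop :=
  forall t u, 0 <= t <= 1 -> `|u - t| <= e -> tau (H (t, x)) (H (u, x)) \in unitmx.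

(** Near each time [t0], invertibility for [t = u] persists for close times and base points.
    Compactness of the interval makes this uniform in [t], with the step bound and the base point
    treated together as a parameter near [(0, x)]. *)
Lemma good_step_near (x : M) : exists2 e, 0 < e & \forall y \near x, good_step y e.
Proof.
have : compact `[0 : R, 1]%classic by exact: segment_compact.
move=> /compact_near_coveringP.
move=> /(_ (R * M)%type (filter_prod (nbhs (0 : R)) (nbhs x))
  (fun ey t => forall u, `|u - t| <= ey.1 ->
     tau (H (t, ey.2)) (H (u, ey.2)) \in unitmx)).
case=> [|[A B] /= [[d /= d0 dA] xB] AB].
- move=> t0 _.
  have ac (z : R * R * M) : {for z, continuous (fun z => z.1.1)}.
    by apply: (@continuous_comp _ _ _ fst fst); exact: cvg_fst.
  have bc (z : R * R * M) : {for z, continuous (fun z => z.1.2)}.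
    by apply: (@continuous_comp _ _ _ fst snd); [exact: cvg_fst|exact: cvg_snd].
  have cc (z : R * R * M) : {for z, continuous snd} by exact: cvg_snd.
  have fc : {for ((t0, t0), x), continuous (fun z : R * R * M => H (z.1.1, z.2))}.
    apply: (@continuous_comp _ _ _ (fun z : R * R * M => (z.1.1, z.2)) H).
      exact: cvg_pair (ac _) (cc _).
    exact: Hc.
  have gc : {for ((t0, t0), x), continuous (fun z : R * R * M => H (z.1.2, z.2))}.
    apply: (@continuous_comp _ _ _ (fun z : R * R * M => (z.1.2, z.2)) H).
      exact: cvg_pair (bc _) (cc _).
    exact: Hc.
  have [[P Q] /= [[[P1 P2] /= [tP1 tP2] PP] xQ] PQ] :=
    tau_unit_near cG rhoP fc gc erefl.
  have [d /= d0 dP] := (nbhs_ballP _ _).1 (filterI tP1 tP2).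
  (* With [t] within [d / 2] of [t0] and [u] within [d / 2] of [t], both times stay within [d] of
     [t0]. *)
  exists (ball t0 (d / 2), (ball (0 : R) (d / 2)) `*` Q) => /=.
    split; first by apply: nbhsx_ballx; rewrite divr_gt0.
    exists (ball (0 : R) (d / 2), Q) => //=; split => //.
    by apply: nbhsx_ballx; rewrite divr_gt0.
  move=> [t [e y]] /= [td [ed Qy]] u ut.
  apply: (PQ ((t, u), y)) => /=; split => //=; apply: PP => /=.
  rewrite -!ball_normE /= in td ed dP.
  have dt2 : d / 2 < d by rewrite ltr_pdivrMr// ltr_pMr// ltr1n.
  split; first by apply: (dP t _).1; rewrite /=; exact: lt_trans dt2.
  apply: (dP u _).2; rewrite /= (splitr d); apply: le_lt_trans (ler_distD t _ _) _.
  apply: ltrD => //; rewrite distrC; apply: le_lt_trans ut _.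
  by apply: le_lt_trans (ler_norm _) _; rewrite -normrN -sub0r.
- exists (d / 2); first by rewrite divr_gt0.
  apply: filterS xB => y By t u t01 ut.
  apply: (AB (d / 2, y)) => //.
  split => //=; apply: dA; rewrite /ball_ /= sub0r normrN gtr0_norm ?divr_gt0//.
  by rewrite ltr_pdivrMr// ltr_pMr// ltr1n.
Qed.

Lemma step_size_exists (x0 : M) : exists eps : M -> R, forall x : M,
  [/\ {for x, continuous eps}, 0 < eps x & good_step x (eps x)].
Proof.
have /choice [e eP] : forall x : M, exists e,
    0 < e /\ \forall y \near x, good_step y e.
  by move=> x; have [e] := good_step_near x; exists e.
have [s' [rho' rhoP']] := @smooth_partition_exists _ _ x0
  (fun x => [set y | good_step y (e x)]) (fun x => (eP x).2).
have [eps epsP] := partition_average rhoP' (fun x => (eP x).1).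
exists eps => x; have [epsc eps0 [p Op le]] := epsP x; split=> // t u t01 ut.
by apply: Op => //; exact: le_trans le.
Qed.

Section Stages.
Variable eps : M -> R.
Hypothesis epsP : forall x : M,
  [/\ {for x, continuous eps}, 0 < eps x & good_step x (eps x)].

Let stage n (x : M) : M := H (n%:R * eps x, x).

(** Starting from the inner product on the fibre over [phi x], rather than from the identity, makes
    every stage a pairing of that fibre with the fibre over [stage n x]. *)
Fixpoint chain n (x : M) : 'M[R]_r :=
  if n is n'.+1 then
    chain n' x *m invmx (tau (stage n' x) (stage n' x)) *m
      tau (stage n' x) (stage n'.+1 x)
  else tau (stage 0 x) (stage 0 x).

Lemma stage_cts n x : {for x, continuous (stage n)}.
Proof.
have [ec _ _] := epsP x.
apply: (@continuous_comp _ _ _ (fun x : M => (n%:R * eps x, x)) H); last exact: Hc.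
have h : {for x, continuous (fun x => n%:R * eps x)}.
  by apply: (germM (continuous_germ_ring R x)) => //; exact: cvg_cst.
have hid : {for x, continuous (@id M)} by exact: cvg_id.
exact: cvg_pair h hid.
Qed.

Lemma chain_cts n x : pair_cts U G x (stage 0) (stage n) (chain n).
Proof.
elim: n => [|n IH].
  exact: (tau_cts cG (@stage_cts 0%N x) (@stage_cts 0%N x)).
exact: (pair_cts_step cG (@stage_cts n x) (@stage_cts n.+1 x) IH).
Qed.

Lemma stage_last n x : 1 <= n%:R * eps x -> stage n x = x.
Proof. exact: H1. Qed.

Lemma chain_unit n x : chain n x \in unitmx.
Proof.
have [_ e0 good] := epsP x.
elim: n => [|n IH] /=; first exact: (tau_unit cG).
rewrite !unitmx_mul IH unitmx_inv (tau_unit cG) /=.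
(* After time 1 both stages are [x] and the factor is [tau x x]; before it, the step starts inside
   the interval and [good_step] applies. *)
have [le|lt] := leP 1 (n%:R * eps x).
  rewrite !stage_last//; first exact: (tau_unit cG).
  by apply: le_trans le _; rewrite ler_pM2r// ler_nat.
apply: good; first by rewrite (ltW lt) andbT mulr_ge0// ltW.
by rewrite -mulrBl -natrB// subSnn mul1r gtr0_norm.
Qed.

(** Once the stage has reached [x], each further factor is the inverse of [tau x x] times [tau x x],
    so the chain is stationary. *)
Lemma chain_last m n x : 1 <= n%:R * eps x -> (n <= m)%N -> chain m x = chain n x.
Proof.
have [_ e0 _] := epsP x.
move=> le /subnK <-; elim: (m - n)%N => //= k <-.
have le' l : (n <= l)%N -> 1 <= l%:R * eps x.
  by move=> nl; apply: le_trans le _; rewrite ler_pM2r// ler_nat.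
rewrite !stage_last ?le' ?leq_addl// ?leqW ?leq_addl//.
by rewrite mulmxKV// (tau_unit cG).
Qed.

End Stages.

Lemma transport_exists (x0 : M) : exists K : M -> 'M[R]_r,
  (forall x, K x \in unitmx) /\ (forall x : M, pair_cts U G x phi id K).
Proof.
have [eps epsP] := step_size_exists x0.
(* The inequality is strict so that [N x] steps remain enough on a neighbourhood of [x]. *)
have /choice [N NP] : forall x, exists n : nat, 1 < n%:R * eps x.
  move=> x; have [_ e0 _] := epsP x.
  have [n _ nP] := near_infty_natSinv_lt (PosNum e0).
  exists n.+1; have := nP n (leqnn n); rewrite /=.
  by rewrite -[ltLHS]mul1r ltr_pdivrMr// mulrC.
exists (fun x => chain eps (N x) x); split=> [x|x]; first exact: chain_unit.
have [ec _ _] := epsP x.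
have near_last : \forall y \near x, 1 < (N x)%:R * eps y.
  have h : {for x, continuous (fun y => (N x)%:R * eps y)}.
    by apply: (germM (continuous_germ_ring R x)) => //; exact: cvg_cst.
  apply: (h [set z | 1 < z]).
  exact: (open_nbhs_nbhs (conj (@open_gt R 1) (NP x))).
have h := @chain_cts eps epsP (N x) x; apply: (pair_cts_near _ _ _ h).
- by apply: nearW => y; rewrite mul0r H0.
- by apply: filterS near_last => y /ltW; exact: H1.
(* [N y] need not equal [N x] for [y] near [x]; both chains agree with the one of length
   [maxn (N x) (N y)]. *)
- apply: filterS near_last => y /ltW le.
  rewrite -(chain_last epsP le (leq_maxl _ (N y))).
  by rewrite (chain_last epsP (ltW (NP y)) (leq_maxr _ _)).
Qed.

End Chain.

(** * Smoothing *)

Lemma germ_posdef_near1 (R : realType) (X : topologicalType) (x : X) n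
    (F : X -> 'M[R]_n) :
  germ_mx (fun h => {for x, continuous h}) F -> F x = 1%:M ->
  \forall y \near x, posdef (F y).
Proof.
move=> Fc Fx; have d0 : 0 < n.+1%:R^-1 :> R by [].
suff H : \forall y \near x, forall i j, `|F y i j - (i == j)%:R| <= n.+1%:R^-1.
  by apply: filterS H => y; exact: posdef_near1.
apply: filter_forall => i; apply: filter_forall => j.
have /cvgrPdist_le /(_ _ d0) := Fc i j.
by apply: filterS => y; rewrite Fx mxE distrC.
Qed.

Definition hom_rep (R : realType) (M : manifold R) r
    (G : M -> M -> M -> 'M[R]_r) (phi : M -> M) (B : M -> 'M[R]_r) (a b x : M) :
    'M[R]_r :=
  G a x x *m B x *m G (phi x) b (phi x).

Definition hom_smooth (R : realType) (M : manifold R) r (U : M -> set M)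
    (G : M -> M -> M -> 'M[R]_r) (phi : M -> M) (B : M -> 'M[R]_r) : Prop :=
  forall a b x, U a x -> U b (phi x) ->
    germ_mx (smooth_at x) (hom_rep G phi B a b).

Section Smoothing.
Variables (R : realType) (M : manifold R) (r : nat) (U : M -> set M).
Variable G : M -> M -> M -> 'M[R]_r.
Hypothesis cG : cocycle U G.
Variable phi : M -> M.
Hypothesis phi_smooth : forall x, smooth_pt (@atlas R M) (@atlas R M) x phi.
Variable K : M -> 'M[R]_r.
Hypothesis K_unit : forall x, K x \in unitmx.
Hypothesis K_cts : forall x : M, pair_cts U G x phi id K.

Let Krep (a b x : M) := pair_rep G phi id K a b x.

Lemma coc_smooth_comp a b x : U a (phi x) -> U b (phi x) ->
  germ_mx (smooth_at x) (fun y => G a b (phi y)).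
Proof.
move=> ax bx i j.
exact: (smooth_at_comp (phi_smooth x) (coc_smooth cG ax bx i j)).
Qed.

Lemma hom_smooth_exists (x0 : M) : exists B : M -> 'M[R]_r,
  (forall x, B x \in unitmx) /\ hom_smooth U G phi B.
Proof.
have phic (x : M) : {for x, continuous phi} by case: (phi_smooth x).
have Uin x : U x x by exact: coc_in cG x.
(* In the fixed frames of [x] and [phi x], the constant [C x] inverts [K] exactly at [x]; the
   product is the identity there, hence positive definite nearby. *)
pose C x := invmx (Krep (phi x) x x).
pose O x := [set y | [/\ U x y, U (phi x) (phi y) &
  posdef (C x *m Krep (phi x) x y)]].
have nO x : nbhs x (O x).
  have N1 : nbhs x (U x) := coc_nbhs cG (Uin x).
  have N2 : \forall y \near x, U (phi x) (phi y).
    by apply: phic; exact: (coc_nbhs cG (Uin (phi x))).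
  have N3 : \forall y \near x, posdef (C x *m Krep (phi x) x y).
    apply: germ_posdef_near1.
      apply: (germ_mxM (continuous_germ_ring R x)).
        exact: (germ_mx_cst (continuous_germ_ring R x)).
      exact: K_cts.
    rewrite mulVmx// /Krep /pair_rep !unitmx_mul unitmx_tr K_unit.
    by rewrite !(coc_unit cG).
  by apply: filterS3 N1 N2 N3 => y ? ? ?; split.
have [s [rho rhoP]] := smooth_partition_exists x0 nO.
pose T n x := G x (s n) x *m C (s n) *m G (phi (s n)) (phi x) (phi x).
pose B x := \sum_(n < part_bound rhoP x) rho n x *: T n x.
have inO n x : rho n x != 0 -> O (s n) x by exact: (part_neq0 rhoP).
exists B; split=> [x|a b x ax bx].
  apply: (@posdef_unitl _ _ (K x)); rewrite /B mulmx_suml.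
  under eq_bigr do rewrite -scalemxAl.
  apply: (@posdef_sum _ _ _ (fun n => T n x *m K x) (rho^~ x)).
  - by move=> n; exact: (spart_ge0 rhoP).
  - move=> n rn; have [sx sfx pd] : O (s n) x by apply: inO; rewrite gt_eqF.
    (* [T n x *m K x] is congruent to the product controlled by [O (s n)]: the change of frame on
       the left is matched by its transpose on the right, so positivity carries over. *)
    have -> : T n x *m K x = G x (s n) x *m
        (C (s n) *m Krep (phi (s n)) (s n) x) *m (G x (s n) x)^T.
      rewrite /Krep /pair_rep !mulmxA -[RHS]mulmxA -trmx_mul.
      by rewrite (coc_inv cG)// trmx1 mulmx1.
    by apply: posdef_conj => //; apply: (coc_unit cG).
  - have [n rn] := spart_gt0 rhoP x; exists n => //.
    by rewrite ltnNge; apply/negP => /part_boundP r0; rewrite r0 ltxx in rn.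
have gR := smooth_at_germ_ring x.
have [N finN] := spart_fin rhoP x.
apply: (@germ_mx_near _ _ _ _ gR _ _ (fun y => \sum_(n < N)
    rho n y *: (G a (s n) y *m C (s n) *m G (phi (s n)) b (phi y)))).
  have Na : nbhs x (U a) := coc_nbhs cG ax.
  have Nb : \forall y \near x, U b (phi y) by apply: phic; exact: (coc_nbhs cG bx).
  apply: filterS3 Na Nb finN => y ay by_ finy.
  rewrite /hom_rep /B (@sum_widen _ (fun n => rho n y *: T n y) (part_bound _ _) N);
    first last.
  - by move=> n /finy ->; rewrite scale0r.
  - by move=> n /part_boundP ->; rewrite scale0r.
  rewrite mulmx_sumr mulmx_suml; apply: eq_bigr => n _.
  have [->|/inO [sy sfy _]] := eqVneq (rho n y) 0.
    by rewrite !scale0r mulmx0 mul0mx.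
  rewrite -scalemxAr -scalemxAl /T; congr (_ *: _).
  rewrite !mulmxA (coc_comp cG)// -[RHS]mulmxA (coc_comp cG)//.
apply: (germ_mx_sum gR) => n _.
have [[sx sfx _]|nO'] := pselect (O (s n) x); last first.
  apply: (germ_mx_near gR) (germ_mx_cst gR 0).
  by apply: filterS (spart_supp rhoP nO') => y ->; rewrite scale0r.
apply: (germ_mxZ gR); first exact: (spart_smooth rhoP).
apply: (germ_mxM gR); last exact: coc_smooth_comp.
by apply: (germ_mxM gR); [exact: (coc_smooth cG)|exact: (germ_mx_cst gR)].
Qed.

End Smoothing.

(** * Bundle maps *)

Section Bundle.
Variables (R : realType) (M : manifold R) (V : vector_bundle M).
Local Notation r := (bundle_rank V).
Local Notation p := (@Defs.proj R M V).
Variables (U : M -> set M) (h : M -> V -> 'rV[R]_r) (k : M -> M * 'rV[R]_r -> V).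
Hypothesis Uin : forall a, U a a.
Hypothesis tP : forall a,
  is_trivialization p (@fibre_incl R M V) (U a) (h a) (k a).

Definition transition (a b x : M) : 'M[R]_r :=
  \matrix_(i, j) h b (k a (x, 'e_i)) 0 j.
Local Notation G := transition.

Lemma triv_proj a x w : U a x -> p (k a (x, w)) = x.
Proof. by move=> ax; have [] := triv_invK (tP a) (z := (x, w)) ax. Qed.

Lemma triv_coord a x w : U a x -> h a (k a (x, w)) = w.
Proof. by move=> ax; have [] := triv_invK (tP a) (z := (x, w)) ax. Qed.

Lemma triv_K a v x : p v = x -> U a x -> k a (x, h a v) = v.
Proof. by move=> <- ax; exact: (triv_mapK (tP a) ax). Qed.

Lemma fibre_ex v x : p v = x -> exists e : fibre V x, fibre_incl e = v.
Proof.
move=> pv; have : (p @^-1` [set x]) v by [].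
by rewrite -fibre_incl_range => -[e _ <-]; exists e.
Qed.

Lemma triv_lin a x : U a x -> linear (fun e : fibre V x => h a (fibre_incl e)).
Proof. by move=> ax; exact: (triv_linear (tP a) ax). Qed.

(** Linearity is given for [h] only. Lifting [k a (x, w1)] and [k a (x, w2)] to the abstract fibre
    and using that [h a] and [k a] are mutually inverse there transfers it to [k a]. *)
Lemma transition_linear a b x : U a x -> U b x ->
  linear (fun w => h b (k a (x, w))).
Proof.
move=> ax bx c w1 w2.
have [e1 E1] := fibre_ex (triv_proj w1 ax).
have [e2 E2] := fibre_ex (triv_proj w2 ax).
have L := triv_lin ax c e1 e2; rewrite /= E1 E2 !triv_coord// in L.
by rewrite -L triv_K ?proj_incl// (triv_lin bx) E1 E2.
Qed.

Lemma transitionE a b x w : U a x -> U b x -> h b (k a (x, w)) = w *m G a b x.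
Proof.
move=> ax bx; pose fM := GRing.isLinear.Build _ _ _ _ _ (transition_linear ax bx).
pose f : {linear 'rV[R]_r -> 'rV[R]_r} := HB.pack (fun w => h b (k a (x, w))) fM.
rewrite -[LHS]/(f w) [in LHS](row_sum_delta w) linear_sum.
apply/rowP => j; rewrite summxE mxE; apply: eq_bigr => i _.
by rewrite linearZ /= !mxE.
Qed.

Lemma h_transition a b v x : p v = x -> U a x -> U b x -> h b v = h a v *m G a b x.
Proof. by move=> pv ax bx; rewrite -transitionE// triv_K. Qed.

Lemma k_transition a b x w : U a x -> U b x -> k a (x, w) = k b (x, w *m G a b x).
Proof.
by move=> ax bx; rewrite -transitionE// triv_K// triv_proj.
Qed.

Lemma transition_cocycle : cocycle U G.
Proof.
split=> //.
- by move=> a; exact: (triv_open (tP a)).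
- move=> a b x ax bx i j.
  (* An entry is a composite of smooth maps: the constant section given by a basis vector, the map
     [k a], the trivialization [b], and a coordinate. *)
  have ks := triv_inv_smooth (tP a) (x := (x, 'e_i)) (conj ax I).
  have pkx : U b (p (k a (x, 'e_i))) by rewrite triv_proj.
  have hs := triv_smooth (tP b) pkx.
  have Ts := smooth_pt_comp (@triv_atlas_is_chart R M r) (@atlas_is_chart R V)
    (@atlas_covers R V) ks hs.
  have T2 := smooth_pt_comp (@atlas_is_chart R M) (@triv_atlas_is_chart R M r)
    (@triv_atlas_covers R M r) (smooth_pt_slice x 'e_i) Ts.
  have H := atlas_smooth_at_comp (@atlas_is_chart R M) (@triv_atlas_is_chart R M r)
    (@triv_atlas_covers R M r) T2 (@triv_smooth_at_snd R M r _ j).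
  by under eq_fun do rewrite mxE.
- move=> a b c x ax bx cx; apply/row_matrixP => i.
  rewrite rowE [in RHS]rowE mulmxA -!transitionE//.
  by rewrite triv_K// triv_proj.
- move=> a x ax; apply/row_matrixP => i.
  by rewrite rowE [in RHS]rowE -transitionE// triv_coord// mulmx1.
Qed.

Definition bundle_map (phi : M -> M) (B : M -> 'M[R]_r) (v : V) : V :=
  k (phi (p v)) (phi (p v), h (p v) v *m B (p v)).

Lemma bundle_map_proj phi B v : p (bundle_map phi B v) = phi (p v).
Proof. exact: triv_proj. Qed.

Lemma bundle_mapK phi psi (B B' : M -> 'M[R]_r) :
  cancel phi psi -> (forall x, B x *m B' (phi x) = 1%:M) ->
  cancel (bundle_map phi B) (bundle_map psi B').
Proof.
move=> phiK BK v; rewrite {1}/bundle_map bundle_map_proj phiK.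
by rewrite /bundle_map triv_coord// -mulmxA BK mulmx1 triv_K.
Qed.

Lemma bundle_map_smooth phi (B : M -> 'M[R]_r) :
  (forall x, smooth_pt (@atlas R M) (@atlas R M) x phi) ->
  hom_smooth U G phi B -> smooth (bundle_map phi B).
Proof.
move=> phis Bs v _.
change (smooth_pt (@atlas R V) (@atlas R V) v (bundle_map phi B)).
pose x := p v; pose a := x; pose b := phi x.
have phic : {for x, continuous phi} by case: (phis x).
have pc : {for v, continuous p} by have [] := proj_smooth (I : setT v).
pose rep := hom_rep G phi B a b.
pose m (z : M * 'rV[R]_r) := (phi z.1, z.2 *m rep z.1).
pose t v := (p v, h a v).
have cG := transition_cocycle.
have Na : \forall u \near v, U a (p u).
  by apply: pc; apply: (coc_nbhs cG); exact: Uin.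
have Nb : \forall u \near v, U b (phi (p u)).
  have : nbhs (phi x) (U b) by apply: (coc_nbhs cG); exact: Uin.
  by move=> /phic /pc.
(* The defining formula uses the frames at [p u] and [phi (p u)], which jump with [u]. Near [v] it
   is rewritten in the fixed trivializations [a] and [b], where [B] becomes the smooth matrix
   [rep]. *)
apply: (@smooth_pt_near _ _ _ _ _ _ _ (@atlas_is_chart R V) _ (k b \o (m \o t))).
  apply: filterS2 Na Nb => u au bu; rewrite /bundle_map /=.
  rewrite [RHS](@k_transition _ b)//; congr (k b (_, _)).
  rewrite /rep /hom_rep !mulmxA (@h_transition a (p u) u (p u)).
  - by [].
  - by [].
  - exact: au.
  - exact: Uin.
have ms : smooth_pt (@triv_atlas R M r) (@triv_atlas R M r) (t v) m.
  have gR := triv_smooth_at_germ_ring (t v).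
  have coords j : triv_smooth_at (t v) (fun z => (z.2 *m rep z.1) 0 j).
    have H : germ_mx (triv_smooth_at (t v))
        (fun z : M * 'rV[R]_r => z.2 *m rep z.1).
      apply: (@germ_mxM _ _ _ _ gR _ _ _ snd (fun z => rep z.1)) => i l.
        by rewrite ord1; exact: triv_smooth_at_snd.
      apply: (@triv_smooth_at_fst _ _ _ _ (fun y => rep y i l)).
      exact: (Bs a b x (Uin _) (Uin _) i l).
    exact: H.
  apply: smooth_pt_coord.
    have h1 : {for t v, continuous (fun z : M * 'rV[R]_r => phi z.1)}.
      by apply: (@continuous_comp _ _ _ fst phi); [exact: cvg_fst|].
    have h2 : {for t v, continuous (fun z : M * 'rV[R]_r => z.2 *m rep z.1)}.
      by apply: continuous_row => j; exact: (germ_cts gR).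
    exact: cvg_pair h1 h2.
  move=> _ [c Ac [d -> <-]] /= [cx _] j.
  rewrite (_ : (fun y => _) = (fun y : M * 'rV[R]_r => match fintype.split j with
    inl i => chart_map c (phi y.1) 0 i | inr i => (y.2 *m rep y.1) 0 i end));
    last first.
    by apply/funext => y; rewrite mxE.
  case: fintype.split => i; last exact: coords.
  apply: (@triv_smooth_at_fst _ _ _ _ (fun y => chart_map c (phi y) 0 i)).
  exact: (smooth_at_comp (phis x) (smooth_at_chart i Ac cx)).
have ts : smooth_pt (@atlas R V) (@triv_atlas R M r) v t :=
  triv_smooth (tP a) (x := v) (Uin _).
have ks : smooth_pt (@triv_atlas R M r) (@atlas R V) (m (t v)) (k b) :=
  triv_inv_smooth (tP b) (x := m (t v)) (conj (Uin _) I).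
have mt := smooth_pt_comp (@atlas_is_chart R V) (@triv_atlas_is_chart R M r)
    (@triv_atlas_covers R M r) ts ms.
have H := smooth_pt_comp (@atlas_is_chart R V) (@triv_atlas_is_chart R M r)
    (@triv_atlas_covers R M r) mt ks.
exact: H.
Qed.

End Bundle.

(** * Assembling the automorphism *)

Lemma within_continuous_comp (S T X : topologicalType) (A : set T) (f : S -> T)
    (g : T -> X) :
  {within A, continuous g} -> continuous f -> (forall x, A (f x)) ->
  continuous (g \o f).
Proof.
move=> gc fc Af x W gW.
have : within A (nbhs (f x)) (g @^-1` W).
  by rewrite nbhs_subspace_in//; exact: gc gW.
move=> N; have {}N : \forall y \near x, A (f y) -> W (g (f y)) := fc x _ N.
by apply: filterS N => y; exact.
Qed.

(** Clamping the time to the unit interval turns continuity within a closed subset into continuity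
    everywhere, and lets a subdivision overshoot time 1. *)
Lemma homotopic_extend (R : realType) (S T : topologicalType) (f g : S -> T) :
  homotopic R f g -> exists H : R * S -> T,
    [/\ continuous H, forall x, H (0, x) = f x
      & forall t x, 1 <= t -> H (t, x) = g x].
Proof.
move=> [H [Hc H0 H1]]; pose clamp (z : R * S) := (Num.max 0 (Num.min 1 z.1), z.2).
exists (H \o clamp); split=> [|x|t x t1].
- apply: within_continuous_comp Hc _ _ => [z|z].
    have c1 (t : R) : {for t, continuous (fun t : R => Num.max 0 (Num.min 1 t))}.
      have c2 : {for t, continuous (fun t : R => Num.min 1 t)}.
        by apply: continuous_min; [exact: cvg_cst|exact: cvg_id].
      by apply: continuous_max; [exact: cvg_cst|exact: c2].
    have c3 : {for z, continuous (@fst R S)} by exact: cvg_fst.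
    have h1 := continuous_comp c3 (c1 z.1).
    have h2 : {for z, continuous (fun z : R * S => z.2)} by exact: cvg_snd.
    exact: cvg_pair h1 h2.
  split=> //=; rewrite in_itv /= le_max lexx /=.
  by rewrite ge_max ler01 ge_min lexx.
- by rewrite /= /clamp /= (min_idPr ler01) maxxx.
- by rewrite /= /clamp /= (min_idPl t1) (max_idPr ler01).
Qed.

(** In the frames [a], [b] the inverse is represented by the inverse matrix of the representative of
    [B] in the frames [b], [a], composed with [psi]. Smoothness thus comes from Cramer's rule and
    needs no inverse function theorem. *)
Lemma hom_smooth_inv (R : realType) (M : manifold R) r (U : M -> set M)
    (G : M -> M -> M -> 'M[R]_r) (phi psi : M -> M) (B : M -> 'M[R]_r) :
  cocycle U G -> cancel psi phi ->
  (forall x, smooth_pt (@atlas R M) (@atlas R M) x psi) ->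
  (forall x, B x \in unitmx) -> hom_smooth U G phi B ->
  hom_smooth U G psi (fun y => invmx (B (psi y))).
Proof.
move=> cG psiK psis uB Bs a b y ay by_.
have gR := smooth_at_germ_ring y.
have psic : {for y, continuous psi} by case: (psis y).
have repc : germ_mx (smooth_at y) (fun z => hom_rep G phi B b a (psi z)).
  move=> i j; have ay' : U a (phi (psi y)) by rewrite psiK.
  exact: (smooth_at_comp (psis y) (Bs b a (psi y) by_ ay' i j)).
have urep z : U a z -> U b (psi z) -> hom_rep G phi B b a (psi z) \in unitmx.
  move=> az bz; rewrite /hom_rep psiK !unitmx_mul uB.
  by rewrite !(coc_unit cG)//; exact: (coc_in cG).
apply: (germ_mx_near gR) (germ_invmx gR repc (urep y ay by_)).
have Na : nbhs y (U a) := coc_nbhs cG ay.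
have Nb : \forall z \near y, U b (psi z) by apply: psic; exact: (coc_nbhs cG by_).
apply: filterS2 Na Nb => z az bz; apply: invmx_eq.
have Uz w : U w w := coc_in cG w.
rewrite /hom_rep psiK !mulmxA -[_ *m G z a z *m G a z z]mulmxA (coc_inv cG)//.
by rewrite mulmx1 mulmxK// (coc_inv cG).
Qed.

Section BundleMapAut.
Variables (R : realType) (M : manifold R) (V : vector_bundle M).
Local Notation r := (bundle_rank V).
Local Notation p := (@Defs.proj R M V).
Variables (U : M -> set M) (h : M -> V -> 'rV[R]_r) (k : M -> M * 'rV[R]_r -> V).
Hypothesis Uin : forall a, U a a.
Hypothesis tP : forall a,
  is_trivialization p (@fibre_incl R M V) (U a) (h a) (k a).
Variables (phi psi : M -> M) (B B' : M -> 'M[R]_r).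
Hypothesis phiK : cancel phi psi.
Hypothesis psiK : cancel psi phi.
Hypothesis BK : forall x, B x *m B' (phi x) = 1%:M.
Hypothesis BK' : forall y, B' y *m B (psi y) = 1%:M.

(** The map on abstract fibres is obtained by choice; it is linear because in the coordinates [h] it
    is multiplication by [B x], and these coordinates are injective on a fibre. The bundle map of
    [psi] and [B'] supplies its inverse. *)
Lemma bundle_map_fibre_iso x : maps_fibre_iso (bundle_map h k phi B) x (phi x).
Proof.
pose Phi := bundle_map h k phi B; pose Psi := bundle_map h k psi B'.
have pPhi v : p (Phi v) = phi (p v) by exact: (bundle_map_proj Uin tP).
have pPsi v : p (Psi v) = psi (p v) by exact: (bundle_map_proj Uin tP).
have /choice [L LP] : forall e : fibre V x, exists e' : fibre V (phi x),
    fibre_incl e' = Phi (fibre_incl e).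
  by move=> e; apply: fibre_ex; rewrite pPhi proj_incl.
have /choice [L' LP'] : forall e' : fibre V (phi x), exists e : fibre V x,
    fibre_incl e = Psi (fibre_incl e').
  by move=> e; apply: fibre_ex; rewrite pPsi proj_incl phiK.
have hL e : h (phi x) (fibre_incl (L e)) = h x (fibre_incl e) *m B x.
  by rewrite LP /Phi /bundle_map proj_incl (triv_coord tP).
have h_inj : injective (fun e : fibre V (phi x) => h (phi x) (fibre_incl e)).
  move=> e e' E; apply: (@fibre_incl_inj R M V).
  rewrite -[LHS](@triv_K _ _ _ _ _ _ tP (phi x) _ (phi x)) ?proj_incl// E.
  by rewrite (@triv_K _ _ _ _ _ _ tP (phi x) _ (phi x)) ?proj_incl.
have L_lin : linear L.
  move=> c e1 e2; apply: h_inj.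
  rewrite (triv_lin tP (Uin (phi x)) c) !hL (triv_lin tP (Uin x) c).
  by rewrite mulmxDl scalemxAl.
pose fM := GRing.isLinear.Build _ _ _ _ _ L_lin.
pose Llin : {linear fibre V x -> fibre V (phi x)} := HB.pack L fM.
exists Llin => //; exists L' => e.
  apply: (@fibre_incl_inj R M V); rewrite LP' LP.
  exact: (bundle_mapK Uin tP phiK BK).
apply: (@fibre_incl_inj R M V); rewrite LP LP'.
exact: (bundle_mapK Uin tP psiK BK').
Qed.

End BundleMapAut.

(** Every fibre contains 0, and the projection of the image of that vector determines the target
    fibre. *)
Lemma maps_fibre_iso_unique (R : realType) (M : manifold R) (V : vector_bundle M)
    (Phi : V -> V) (x y z : M) :
  maps_fibre_iso Phi x y -> maps_fibre_iso Phi x z -> y = z.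
Proof.
move=> [L _ LP] [L' _ LP'].
by rewrite -(proj_incl (L 0)) -LP LP' proj_incl.
Qed.

Theorem proposition7 (R : realType) (M : manifold R) (V : vector_bundle M)
    (phi : M -> M) (phi_diff : Diff M phi) (phi_id : homotopic R phi id) :
  exists2 Phi : V -> V, AUT V Phi & hV Phi = phi.
Proof.
(* An empty [M] offers no default point [x0]; then [V] is empty as well and the identity works
   vacuously. *)
have [[x0 _]|M0] := pselect (exists x0 : M, True); last first.
  exists id; last by apply/funext => x; case: M0; exists x.
  split; last by move=> x; case: M0; exists x.
  by exists id; split=> // v _; case: M0; exists (Defs.proj v).
have [psi [phiK psiK phis psis]] := phi_diff.
have [H [Hc H0 H1]] := homotopic_extend phi_id.
have /choice [U /choice [h /choice [k hk]]] := @locally_trivial R M V.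
have Uin a : U a a by case: (hk a).
have tP a := (hk a).2.
have cG := transition_cocycle Uin tP.
have nU x : nbhs x (U x) by exact: (coc_nbhs cG (Uin x)).
have [s [rho rhoP]] := smooth_partition_exists x0 nU.
have [K [uK Kc]] := transport_exists cG rhoP Hc H0 H1 x0.
have [B [uB Bs]] := hom_smooth_exists cG (fun x => phis x I) uK Kc x0.
pose B' y := invmx (B (psi y)).
have Bs' := hom_smooth_inv cG psiK (fun x => psis x I) uB Bs.
have BK x : B x *m B' (phi x) = 1%:M by rewrite /B' phiK mulmxV.
have BK' y : B' y *m B (psi y) = 1%:M by rewrite mulVmx.
have iso := bundle_map_fibre_iso Uin tP phiK psiK BK BK'.
exists (bundle_map h k phi B).
  split=> [|x]; last by exists (phi x).
  exists (bundle_map h k psi B'); split.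
  - exact: (bundle_mapK Uin tP phiK BK).
  - exact: (bundle_mapK Uin tP psiK BK').
  - exact: (bundle_map_smooth Uin tP (fun x => phis x I) Bs).
  - exact: (bundle_map_smooth Uin tP (fun x => psis x I) Bs').
(* [hV] picks some target fibre; one exists by [iso], and uniqueness forces it to be the one over
   [phi x]. *)
apply/funext => x; apply: (maps_fibre_iso_unique _ (iso x)).
exact: (xgetPex x (ex_intro _ _ (iso x))).
Qed.
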